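(* Let $\mathcal G=\langle S_\Diamond,S_\Box,\overline s,A,\delta\rangle$ be a stochastic game, $\phi=\mathtt{R}^r_{\ge b}[\mathtt{C}]$ a property, and $(\psi,\tau)$ a (static or dynamic) penalty scheme. For any multi-strategy $\theta$ sound for $\phi$, there is a multi-strategy $\theta'$ sound for $\phi$ such that $\mathit{pen}_\tau(\theta)\ge\mathit{pen}_\tau(\theta')$ and $|\mathrm{supp}(\theta'(s))|\le 2$ for every $s\in S_\Diamond$.
   Context: A (turn-based) stochastic game is a tuple $\mathcal{G}=\langle S_\Diamond,S_\Box,\overline{s},A,\delta\rangle$, where $S=S_\Diamond\cup S_\Box$ is a finite set of states partitioned into controller states $S_\Diamond$ and environment states $S_\Box$, $\overline{s}$ the initial state, $A$ a finite set of actions, and $\delta:S\times A\to\mathrm{Dist}(S)$ a partial function with rational probabilities; $A(s)=\{a\mid\delta(s,a)\text{ defined}\}$. Strategies are memoryless: $\sigma:S_\Diamond\to\mathrm{Dist}(A)$, $\pi:S_\Box\to\mathrm{Dist}(A)$, supported on enabled actions, inducing the standard probability measure on paths. A reward structure is $r:S\times A\to\mathbb{Q}_{\ge 0}$; $E^{\sigma,\pi}_{\mathcal G,s}(r)$ is the expectation of $\sum_{j\ge0}r(s_j,a_j)$; it is assumed $\sup_{\sigma,\pi}E^{\sigma,\pi}_{\mathcal G,s}(r)<\infty$. $\phi=\mathtt{R}^r_{\ge b}[\mathtt{C}]$ is satisfied under $(\sigma,\pi)$ iff $E^{\sigma,\pi}_{\mathcal G,\overline s}(r)\ge b$; $\sigma$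 is sound for $\phi$ if this holds for all $\pi$. A multi-strategy is $\theta:S_\Diamond\to\mathrm{Dist}(2^A)$ with $\theta(s)(\emptyset)=0$ (sets at $s$ are subsets of $A(s)$); $\mathrm{supp}(\theta(s))$ is the set of subsets given positive probability. $\sigma$ complies with $\theta$ ($\sigma\triangleleft\theta$) if for every $s\in S_\Diamond$ and nonempty $B\subseteq A(s)$ there is $d_{s,B}\in\mathrm{Dist}(B)$ with $\sigma(s)(a)=\sum_{B\ni a}\theta(s)(B)d_{s,B}(a)$ for all $a\in A(s)$; $\theta$ is sound for $\phi$ if every $\sigma\triangleleft\theta$ is sound. A penalty scheme is $(\psi,\tau)$ with $\psi:S_\Diamond\times A\to\mathbb{Q}_{\ge0}$, $\tau\in\{\mathit{sta},\mathit{dyn}\}$. Local penalty: $\mathit{pen}_{loc}(\theta,s)=\sum_{B\subseteq A(s)}\sum_{a\in A(s)\setminus B}\theta(s)(B)\psi(s,a)$. Static: $\mathit{pen}_{sta}(\theta)=\sum_{s\in S_\Diamond}\mathit{pen}_{loc}(\theta,s)$. Dynamic: with $r_\theta(s,a)=\mathit{pen}_{loc}(\theta,s)$ for $s\in S_\Diamond$ and $0$ for $s\in S_\Box$, $\mathit{pen}_{dyn}(\theta)=\sup\{E^{\sigma,\pi}_{\mathcal G,\overline s}(r_\theta)\mid\sigma\triangleleft\theta,\pi\}$ (possibly $\infty$). *)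

(* Defs.v *)
From HB Require Import structures.
From mathcomp Require Import all_boot all_order all_algebra.
From mathcomp Require Import all_classical all_reals all_analysis.

Set Implicit Arguments.
Unset Strict Implicit.
Unset Printing Implicit Defensive.

Import Order.TTheory GRing.Theory Num.Theory.
Import numFieldNormedType.Exports.

Local Open Scope classical_set_scope.
Local Open Scope ring_scope.

Record dist (K : numDomainType) (T : finType) := Dist {
  dist_fun :> {ffun T -> K};
  dist_ge0 : forall x, 0 <= dist_fun x;
  dist_sum1 : \sum_x dist_fun x = 1 }.

Definition supp (K : numDomainType) (T : finType) (d : dist K T) : {set T} :=
  [set x | 0 < d x]%SET.

Section DistConstructions.
Variables (R : realType) (T A : finType).

Lemma dirac_dist_ge0 (x y : T) : 0 <= [ffun y => (y == x)%:R : R] y.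
Proof. by rewrite ffunE ler0n. Qed.

Lemma dirac_dist_sum1 (x : T) : \sum_y [ffun y => (y == x)%:R : R] y = 1.
Proof.
rewrite (bigD1 x) //= ffunE eqxx big1 ?addr0 // => y /negbTE yx.
by rewrite ffunE yx.
Qed.

Definition dirac_dist (x : T) : dist R T :=
  Dist (@dirac_dist_ge0 x) (dirac_dist_sum1 x).

Lemma ratr_dist_ge0 (d : dist rat T) x : 0 <= [ffun x => ratr (d x) : R] x.
Proof. by rewrite ffunE ler0q dist_ge0. Qed.

Lemma ratr_dist_sum1 (d : dist rat T) :
  \sum_x [ffun x => ratr (d x) : R] x = 1.
Proof.
under eq_bigr do rewrite ffunE.
by rewrite -rmorph_sum dist_sum1 rmorph1.
Qed.

Definition ratr_dist (d : dist rat T) : dist R T :=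
  Dist (@ratr_dist_ge0 d) (ratr_dist_sum1 d).

Lemma compose_dist_ge0 (m : dist R T) (f : T -> dist R A) x :
  0 <= [ffun x : T * A => m x.1 * f x.1 x.2] x.
Proof. by rewrite ffunE mulr_ge0 ?dist_ge0. Qed.

Lemma compose_dist_sum1 (m : dist R T) (f : T -> dist R A) :
  \sum_x [ffun x : T * A => m x.1 * f x.1 x.2] x = 1.
Proof.
under eq_bigr do rewrite ffunE.
rewrite -(pair_bigA _ (fun t a => m t * f t a)) /= -[RHS](dist_sum1 m).
by apply: eq_bigr => t _; rewrite -mulr_sumr dist_sum1 mulr1.
Qed.

(* Joint law of (t, a) where t has law m and, given t, a has law f t. *)
Definition compose_dist (m : dist R T) (f : T -> dist R A) : dist R (T * A)%type :=
  Dist (@compose_dist_ge0 m f) (compose_dist_sum1 m f).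

End DistConstructions.

Lemma dist_inhabited (K : numDomainType) (T : finType) (d : dist K T) :
  exists x : T, true.
Proof.
case: (pickP (@predT T)) => [x _|T0]; first by exists x.
have := dist_sum1 d; rewrite big_pred0 // => /esym/eqP.
by rewrite oner_eq0.
Qed.

(* Infinite sequences over X. The argument d is a phantom: it exhibits an
   element of X, which the library requires of a measurable type. *)
Definition paths (K : numDomainType) (X : finType) (d : dist K X) := nat -> X.

Definition cylinder (X : finType) (w : seq X) : set (nat -> X) :=
  [set o | mkseq o (size w) = w].

Section PathSpace.
Variables (K : numDomainType) (X : finType) (d : dist K X).

HB.instance Definition _ := gen_eqMixin (paths d).
HB.instance Definition _ := gen_choiceMixin (paths d).
HB.instance Definition _ :=
  isPointed.Build (paths d) (fun _ => xchoose (dist_inhabited d)).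

Definition cylinders : set (set (paths d)) := [set cylinder w | w in setT].

HB.instance Definition _ :=
  Measurable.copy (paths d) (g_sigma_algebraType cylinders).

End PathSpace.

Arguments cylinders {K X} d _.

(* Probability that the Markov chain with initial law m and kernel k starts
   with the word w = x_0 ... x_n, that is m x_0 * k x_0 x_1 * ... *)
Fixpoint word_prob (R : realType) (X : finType) (m : dist R X)
    (k : X -> dist R X) (w : seq X) : R :=
  if w is x :: w' then m x * word_prob (k x) k w' else 1.

(* The path measure is obtained as the image of the uniform law on [0, 1[ by
   the map that reads off successive letters from nested subintervals. *)
Section ChainMeasure.
Variables (R : realType) (X : finType).
Implicit Types (m : dist R X) (u : R) (w : seq X).

Let F m (i : nat) : R := \sum_(y | (enum_rank y < i)%N) m y.

Let cum m (x : X) : R := F m (enum_rank x).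

Let F_mono m i j : (i <= j)%N -> F m i <= F m j.
Proof.
move=> ij; rewrite /F [leRHS](bigID (fun y => (enum_rank y < i)%N)) /=.
have -> : \sum_(y | (enum_rank y < j)%N && (enum_rank y < i)%N) m y =
          \sum_(y | (enum_rank y < i)%N) m y.
  apply: eq_bigl => y; rewrite andb_idl // => yi; exact: leq_trans yi ij.
by rewrite lerDl sumr_ge0 // => y _; exact: dist_ge0.
Qed.

Let F_rank m (x : X) : F m (enum_rank x).+1 = cum m x + m x.
Proof.
rewrite /cum /F (bigD1 x) ?ltnS //= addrC; congr (_ + _).
apply: eq_bigl => y; rewrite ltnS ltn_neqAle andbC; congr (_ && _).
by rewrite -[RHS]/(_ != _ :> nat) (inj_eq val_inj) (inj_eq enum_rank_inj).
Qed.

Let F0 m : F m 0 = 0. Proof. by rewrite /F big_pred0. Qed.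

Let F1 m : F m #|X| = 1.
Proof. by rewrite -[RHS](dist_sum1 m); apply: eq_bigl => y; rewrite ltn_ord. Qed.

Let inside m x u := cum m x <= u < cum m x + m x.

Let inside_ex m u : 0 <= u < 1 -> exists x, inside m x u.
Proof.
move=> /andP[u0 u1].
have ex : exists i, u < F m i by exists #|X|; rewrite F1.
case: (ex_minnP ex) => -[|i] ui imin; first by move: ui; rewrite F0 ltNge u0.
have iX : (i < #|X|)%N by apply: imin; rewrite F1.
exists (enum_val (Ordinal iX)); rewrite /inside -F_rank /cum enum_valK /= ui andbT.
by rewrite leNgt; apply/negP => /imin; rewrite ltnn.
Qed.

Let inside_inj m u x y : inside m x u -> inside m y u -> x = y.
Proof.
wlog xy : x y / (enum_rank x <= enum_rank y)%N.
  move=> h ix iy; case/orP: (leq_total (enum_rank x) (enum_rank y)) => xy.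
    exact: h.
  by apply/esym; exact: h.
move=> /andP[_ ux] /andP[yu _]; apply/enum_rank_inj/val_inj/eqP => /=.
rewrite eqn_leq xy leqNgt; apply/negP => /(F_mono m).
by rewrite F_rank leNgt (le_lt_trans yu ux).
Qed.

Let draw m u := odflt (xchoose (dist_inhabited m)) [pick x | inside m x u].

Let drawP m u : 0 <= u < 1 -> inside m (draw m u) u.
Proof.
move=> /(inside_ex m)[x xu]; rewrite /draw; case: pickP => //= h.
by move: xu; rewrite h.
Qed.

Let rescale m u := (u - cum m (draw m u)) / m (draw m u).

Variable k : X -> dist R X.

Fixpoint run_of m u (n : nat) : X :=
  if n is n'.+1 then run_of (k (draw m u)) (rescale m u) n' else draw m u.

Fixpoint left_end m w : R :=
  if w is x :: w' then cum m x + m x * left_end (k x) w' else 0.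

Let word_prob_ge0 m w : 0 <= word_prob m k w.
Proof. by elim: w m => //= x w IH m; rewrite mulr_ge0 ?dist_ge0. Qed.

Let left_end_bounds m w : 0 <= left_end m w /\ left_end m w + word_prob m k w <= 1.
Proof.
elim: w m => [|x w IH] m /=; first by rewrite add0r.
have [l0 l1] := IH (k x); split.
  by rewrite addr_ge0 ?mulr_ge0 ?dist_ge0 // -[leLHS](F0 m) F_mono.
rewrite -addrA -mulrDr (@le_trans _ _ (cum m x + m x)) //.
  by rewrite lerD2l ler_piMr // dist_ge0.
by rewrite -F_rank -(F1 m) F_mono.
Qed.

Let mkseqS (o : nat -> X) n : mkseq o n.+1 = o 0%N :: mkseq (fun i => o i.+1) n.
Proof. by rewrite /mkseq /= -[1%N]addn0 iotaDl -map_comp. Qed.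

Let run_cylinder m u w : 0 <= u < 1 ->
  (mkseq (run_of m u) (size w) == w) =
  (left_end m w <= u < left_end m w + word_prob m k w).
Proof.
elim: w m u => [|x w IH] m u u01; first by rewrite /= add0r u01.
rewrite [size _]/= mkseqS eqseq_cons /=.
have := drawP m u01; set y := draw m u => yu.
have my0 : 0 < m y.
  by case/andP: yu => a b; rewrite -(ltrD2l (cum m y)) addr0 (le_lt_trans a b).
case: eqVneq => [<-{x}|yx] /=.
  have ru : 0 <= rescale m u < 1.
    rewrite /rescale -/y divr_ge0 ?subr_ge0 ?(ltW my0)//=; last by case/andP: yu.
    by rewrite ltr_pdivrMr // mul1r ltrBlDl; case/andP: yu.
  rewrite IH // /rescale -/y ler_pdivlMr // ltr_pdivrMr //.
  rewrite lerBrDl ltrBlDl -addrA -mulrDr.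
  by rewrite ![_ * m y]mulrC.
apply/esym/negbTE/negP => /andP[a b].
have [l0 l1] := left_end_bounds (k x) w.
move/negP: yx; apply; apply/eqP/(inside_inj yu)/andP; split.
  by apply: le_trans a; rewrite lerDl mulr_ge0 ?dist_ge0.
apply: lt_le_trans b _.
by rewrite -addrA -mulrDr lerD2l ler_piMr ?dist_ge0.
Qed.

Variable m : dist R X.

Let I01 : set (measurableTypeR R) := `[0, 1[.

Let mI01 : measurable I01. Proof. exact: measurable_itv. Qed.

Definition unif01 := mrestr (@lebesgue_measure R) mI01.

HB.instance Definition _ := Measure.on unif01.

Let unif01_setT : unif01 setT = 1%E.
Proof.
by rewrite /unif01 /mrestr setTI /I01 lebesgue_measure_itv /= lte_fin ltr01 oppr0 adde0.
Qed.

HB.instance Definition _ := Measure_isProbability.Build _ _ _ unif01 unif01_setT.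

Definition run_map (u : measurableTypeR R) : paths m :=
  run_of m (if 0 <= u < 1 then u else 0).

Let word_itv w : set (measurableTypeR R) :=
  `[left_end m w, left_end m w + word_prob m k w[.

Let run_map_cylinder w : run_map @^-1` cylinder w `&` I01 = word_itv w.
Proof.
have [l0 l1] := left_end_bounds m w.
apply/seteqP; split => u /=.
  rewrite /run_map /I01 /word_itv /= !in_itv /= => -[+ u01]; rewrite u01.
  by move/eqP; rewrite run_cylinder.
rewrite /run_map /I01 /word_itv /= !in_itv /= => uw.
have u01 : 0 <= u < 1.
  case/andP: uw => a b.
  by rewrite (le_trans l0 a) (lt_le_trans b l1).
by split=> //; rewrite u01 /cylinder /=; apply/eqP; rewrite run_cylinder.
Qed.

Let measurable_run_map : measurable_fun setT run_map.
Proof.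
apply: (measurability (cylinders m)) => //.
move=> _ [_ [w _ <-] <-]; rewrite setTI.
rewrite -(setIT (run_map @^-1` _)) -(setvU I01) setIUr run_map_cylinder.
apply: measurableU; last exact: measurable_itv.
have [h|h] := pselect ((cylinder w : set (nat -> X)) (run_of m 0)).
  rewrite (_ : _ `&` _ = ~` I01); first exact: measurableC.
  apply/seteqP; split => [u []//|u /= nu]; split => //.
  by move: nu; rewrite /run_map /I01 /= in_itv /= => /negP/negbTE ->.
rewrite (_ : _ `&` _ = set0) //.
apply/seteqP; split => // u /= [+ nu].
by move: nu; rewrite /run_map /I01 /= in_itv /= => /negP/negbTE ->.
Qed.

HB.instance Definition _ :=
  isMeasurableFun.Build _ _ _ _ run_map measurable_run_map.

Lemma chain_measure_ex : exists P : probability (paths m) R,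
  forall w, P (cylinder w) = (word_prob m k w)%:E.
Proof.
exists (distribution unif01 run_map) => w.
rewrite /distribution /= /pushforward /unif01 /mrestr run_map_cylinder.
rewrite /word_itv lebesgue_measure_itv /= lte_fin ltrDl -EFinD addrC addrA.
rewrite [- _ + _]addrC subrr add0r.
by have := word_prob_ge0 m w; rewrite le_eqVlt => /predU1P[<-|->//]; rewrite ltxx.
Qed.

End ChainMeasure.

(* The (unique) probability measure on infinite sequences that gives every
   cylinder the probability prescribed by m and k. *)
Definition chain_measure (R : realType) (X : finType) (m : dist R X)
    (k : X -> dist R X) : probability (paths m) R :=
  projT1 (cid (chain_measure_ex k m)).

Lemma chain_measureE (R : realType) (X : finType) (m : dist R X)
    (k : X -> dist R X) (w : seq X) :
  chain_measure m k (cylinder w) = (word_prob m k w)%:E.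
Proof. by rewrite /chain_measure; case: cid. Qed.

(* Sc and Se are the controller and environment states, so that the sum type
   Sc + Se is the state space with its partition; None means undefined. *)
Record game (Sc Se A : finType) := Game {
  init : Sc + Se;
  delta : Sc + Se -> A -> option (dist rat (Sc + Se)%type) }.

Section Games.
Variables (R : realType) (Sc Se A : finType) (G : game Sc Se A).
Local Notation state := (Sc + Se)%type.

Definition enabled (s : state) : {set A} := [set a | isSome (delta G s a)]%SET.

Record strategy := Strategy {
  strategy_fun :> Sc -> dist R A;
  strategy_enabled : forall s, supp (strategy_fun s) \subset enabled (inl s) }.

Record env_strategy := EnvStrategy {
  env_strategy_fun :> Se -> dist R A;
  env_strategy_enabled :
    forall s, supp (env_strategy_fun s) \subset enabled (inr s) }.

Definition action_law (sigma : strategy) (pi : env_strategy) (s : state) :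
    dist R A :=
  match s with inl c => sigma c | inr e => pi e end.

(* The value for a disabled action is immaterial, since strategies give
   disabled actions probability 0. *)
Definition succ_law (s : state) (a : A) : dist R state :=
  if delta G s a is Some d then ratr_dist R d else dirac_dist R s.

Section PathMeasure.
Variables (sigma : strategy) (pi : env_strategy) (s : state).

Definition first_step : dist R (state * A)%type :=
  compose_dist (dirac_dist R s) (action_law sigma pi).

Definition next_step (x : state * A) : dist R (state * A)%type :=
  compose_dist (succ_law x.1 x.2) (action_law sigma pi).

(* A path s_0 a_0 s_1 a_1 ... is the sequence of the pairs (s_j, a_j). *)
Definition path_measure : probability (paths first_step) R :=
  chain_measure first_step next_step.

Definition total_reward (rw : state -> A -> R) (o : nat -> state * A) : \bar R :=
  (\sum_(0 <= j <oo) (rw (o j).1 (o j).2)%:E)%E.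

Definition expected_reward (rw : state -> A -> R) : \bar R :=
  (\int[path_measure]_o total_reward rw o)%E.

End PathMeasure.

Definition rat_reward (r : state -> A -> rat) : state -> A -> R :=
  fun s a => ratr (r s a).

Definition bounded_reward (r : state -> A -> rat) : Prop :=
  forall s : state,
    (ereal_sup [set e | exists sigma pi,
       e = expected_reward sigma pi s (rat_reward r)] < +oo)%E.

Definition strategy_sound (r : state -> A -> rat) (b : R) (sigma : strategy) :
    Prop :=
  forall pi : env_strategy,
    (b%:E <= expected_reward sigma pi (init G) (rat_reward r))%E.

Record multi_strategy := MultiStrategy {
  multi_strategy_fun :> Sc -> dist R {set A};
  multi_strategy_set0 : forall s, multi_strategy_fun s finset.set0 = 0;
  multi_strategy_enabled : forall s (B : {set A}),
    B \in supp (multi_strategy_fun s) -> B \subset enabled (inl s) }.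

(* d s B is only constrained when B is a nonempty set of enabled actions. *)
Definition complies (sigma : strategy) (theta : multi_strategy) : Prop :=
  exists d : Sc -> {set A} -> dist R A,
    (forall s (B : {set A}), B != finset.set0 -> B \subset enabled (inl s) ->
       supp (d s B) \subset B) /\
    (forall s a, a \in enabled (inl s) ->
       sigma s a =
       \sum_(B : {set A} | (B \subset enabled (inl s)) && (a \in B))
          theta s B * d s B a).

Definition sound (r : state -> A -> rat) (b : R) (theta : multi_strategy) :
    Prop :=
  forall sigma : strategy, complies sigma theta -> strategy_sound r b sigma.

Definition pen_loc (psi : Sc -> A -> rat) (theta : multi_strategy) (s : Sc) : R :=
  \sum_(B : {set A} | B \subset enabled (inl s))
    \sum_(a in enabled (inl s) :\: B) theta s B * ratr (psi s a).

Definition pen_sta (psi : Sc -> A -> rat) (theta : multi_strategy) : R :=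
  \sum_s pen_loc psi theta s.

Definition pen_reward (psi : Sc -> A -> rat) (theta : multi_strategy) :
    state -> A -> R :=
  fun s _ => match s with inl c => pen_loc psi theta c | inr _ => 0 end.

Definition pen_dyn (psi : Sc -> A -> rat) (theta : multi_strategy) : \bar R :=
  ereal_sup [set e | exists sigma pi, complies sigma theta /\
    e = expected_reward sigma pi (init G) (pen_reward psi theta)].

End Games.

Inductive penalty_type := sta | dyn.

Definition penalty (R : realType) (Sc Se A : finType) (G : game Sc Se A)
    (psi : Sc -> A -> rat) (tau : penalty_type) (theta : multi_strategy R G) :
    \bar R :=
  match tau with
  | sta => (pen_sta psi theta)%:E
  | dyn => pen_dyn psi theta
  end.

(* Main.v *)
(* Attach to every state s the least total reward x s that strategies complying
   with theta can yield, and to every allowed set B the worst one-step value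
   lam s B, so that x s is the theta-average of lam s B; attach also a penalty
   coordinate mu s B (the penalty of B, plus, in the dynamic case, the largest
   expected future penalty). In the plane of the points (lam s B, mu s B), two
   points suffice to keep the average of lam at least x s without increasing
   that of mu.

   This makes x a subsolution of the reward equations of theta', which bounds
   the reward from below only if theta' cannot be trapped in a set of states
   where nothing is earned and x is a positive constant. Hence the two sets are
   chosen to include one that makes progress: either lam s B > x s, or B was
   selected by a backward induction so that it earns something or moves to a
   state handled earlier. For the penalty, a supersolution suffices, but states
   of infinite penalty have to be removed first. *)
Require Import Defs.
From mathcomp Require Import all_boot all_order all_algebra.
From mathcomp Require Import all_classical all_reals all_analysis.
From mathcomp Require Import measurable_realfun ring lra.

Set Implicit Arguments.
Unset Strict Implicit.
Unset Printing Implicit Defensive.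

Import Order.TTheory GRing.Theory Num.Theory.

Local Open Scope ring_scope.

(** * Averages and mixtures over finite distributions *)

Section Mean.
Variable R : realType.
Implicit Types T U : finType.

Definition mean T (m : dist R T) (f : T -> R) : R := \sum_t m t * f t.

(** Values may be infinite; since 0 times an infinite value is 0, points of mass zero do not
    count. *)
Definition emean T (m : dist R T) (v : T -> \bar R) : \bar R :=
  (\sum_t (m t)%:E * v t)%E.

Lemma eq_dist T (m m' : dist R T) : (forall t, m t = m' t) -> m = m'.
Proof.
case: m m' => [f f0 f1] [g g0 g1] /= fg; have e : f = g by apply/ffunP.
by subst g; congr Dist; exact: Prop_irrelevance.
Qed.

Lemma meanD T (m : dist R T) f g :
  mean m (fun t => f t + g t) = mean m f + mean m g.
Proof. by rewrite /mean -big_split; apply: eq_bigr => t _; rewrite mulrDr. Qed.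

Lemma meanB T (m : dist R T) f g :
  mean m (fun t => f t - g t) = mean m f - mean m g.
Proof. by rewrite /mean -sumrB; apply: eq_bigr => t _; rewrite mulrBr. Qed.

Lemma meanZ T (m : dist R T) c f : mean m (fun t => c * f t) = c * mean m f.
Proof. by rewrite /mean mulr_sumr; apply: eq_bigr => t _; rewrite mulrCA. Qed.

Lemma mean_cst T (m : dist R T) c : mean m (fun=> c) = c.
Proof. by rewrite /mean -mulr_suml dist_sum1 mul1r. Qed.

Lemma eq_mean T (m : dist R T) f g :
  (forall t, 0 < m t -> f t = g t) -> mean m f = mean m g.
Proof.
move=> fg; apply: eq_bigr => t _.
by have := dist_ge0 m t; rewrite le0r => /predU1P[->|/fg ->//]; rewrite !mul0r.
Qed.

Lemma ler_mean T (m : dist R T) f g :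
  (forall t, 0 < m t -> f t <= g t) -> mean m f <= mean m g.
Proof.
move=> fg; apply: ler_sum => t _; have := dist_ge0 m t.
rewrite le0r => /predU1P[->|m0]; first by rewrite !mul0r.
by rewrite ler_pM2l // fg.
Qed.

(** Strict inequality at one point of positive mass would make the means strictly ordered. This
    serves as the maximum principle below. *)
Lemma mean_le_eq T (m : dist R T) f g t :
  (forall t, 0 < m t -> f t <= g t) -> mean m g <= mean m f ->
  0 < m t -> f t = g t.
Proof.
move=> fg gf mt; apply/eqP; rewrite eq_le fg //=; move: gf; rewrite leNgt.
apply: contraNT; rewrite -ltNge => ltfg.
rewrite /mean (bigD1 t) //= [ltRHS](bigD1 t) //= ltr_leD ?ltr_pM2l //.
apply: ler_sum => u _; have := dist_ge0 m u.
rewrite le0r => /predU1P[->|m0]; first by rewrite !mul0r.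
by rewrite ler_pM2l // fg.
Qed.

Lemma mean_ge0 T (m : dist R T) f :
  (forall t, 0 < m t -> 0 <= f t) -> 0 <= mean m f.
Proof. by move=> f0; rewrite -(mean_cst m 0) ler_mean. Qed.

Lemma emean_EFin T (m : dist R T) f :
  emean m (fun t => (f t)%:E) = (mean m f)%:E.
Proof. by rewrite /emean /mean -sumEFin; apply: eq_bigr. Qed.

Lemma eq_emean T (m : dist R T) f g :
  (forall t, 0 < m t -> f t = g t) -> emean m f = emean m g.
Proof.
move=> fg; apply: eq_bigr => t _.
by have := dist_ge0 m t; rewrite le0r => /predU1P[->|/fg ->//]; rewrite !mul0e.
Qed.

Lemma lee_emean T (m : dist R T) f g :
  (forall t, 0 < m t -> (f t <= g t)%E) -> (emean m f <= emean m g)%E.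
Proof.
move=> fg; apply: lee_sum => t _; have := dist_ge0 m t.
rewrite le0r => /predU1P[->|m0]; first by rewrite !mul0e.
by rewrite lee_wpmul2l ?lee_fin ?(ltW m0) // fg.
Qed.

Lemma emean_cst T (m : dist R T) (c : \bar R) :
  (0 <= c)%E -> emean m (fun=> c) = c.
Proof.
move=> c0; rewrite /emean -ge0_sume_distrl ?sumEFin ?dist_sum1 ?mul1e // => t _.
by rewrite lee_fin dist_ge0.
Qed.

Lemma emeanD T (m : dist R T) (f g : T -> \bar R) :
  (forall t, 0 <= f t)%E -> (forall t, 0 <= g t)%E ->
  emean m (fun t => f t + g t)%E = (emean m f + emean m g)%E.
Proof.
by move=> f0 g0; rewrite /emean -big_split; apply: eq_bigr => t _; rewrite ge0_muleDr.
Qed.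

Lemma lee_emean_pos T (m : dist R T) f t :
  (forall t, 0 <= f t)%E -> ((m t)%:E * f t <= emean m f)%E.
Proof.
move=> f0; rewrite /emean (bigD1 t) //= leeDl // sume_ge0 // => u _.
by rewrite mule_ge0 ?lee_fin ?dist_ge0.
Qed.

Lemma dist_pos T (m : dist R T) : exists t, 0 < m t.
Proof.
apply/existsP; rewrite -[X in is_true X]negbK; apply/negP => /existsPn h.
have : \sum_t m t <= 0 by apply: sumr_le0 => t _; rewrite leNgt h.
by rewrite dist_sum1 ler10.
Qed.

Lemma mean_dirac T (t : T) f : mean (dirac_dist R t) f = f t.
Proof.
rewrite /mean (bigD1 t) //= ffunE eqxx mul1r big1 ?addr0 // => u /negbTE ut.
by rewrite ffunE ut mul0r.
Qed.

Lemma dirac_pos T (t u : T) : (0 < dirac_dist R t u) = (u == t).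
Proof. by rewrite ffunE ltr0n lt0b. Qed.

Section Mixture.
Variables (T U : finType) (m : dist R T) (k : T -> dist R U).

Let mixture_ge0 u : 0 <= [ffun u => mean m (fun t => k t u)] u.
Proof. by rewrite ffunE mean_ge0 // => t _; exact: dist_ge0. Qed.

Let mixture_sum1 : \sum_u [ffun u => mean m (fun t => k t u)] u = 1.
Proof.
under eq_bigr do rewrite ffunE.
rewrite exchange_big /= -[RHS](dist_sum1 m).
by apply: eq_bigr => t _; rewrite -mulr_sumr dist_sum1 mulr1.
Qed.

(** The marginal on [U] of the joint law [compose_dist m k]. *)
Definition mixture : dist R U := Dist mixture_ge0 mixture_sum1.

Lemma mixtureE u : mixture u = mean m (fun t => k t u).
Proof. by rewrite ffunE. Qed.

Lemma mean_mixture f : mean mixture f = mean m (fun t => mean (k t) f).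
Proof.
rewrite /mean; under eq_bigr do rewrite mixtureE /mean mulr_suml.
rewrite exchange_big; apply: eq_bigr => t _; rewrite mulr_sumr.
by apply: eq_bigr => u _; rewrite mulrA.
Qed.

Lemma mixture_pos t u : 0 < m t -> 0 < k t u -> 0 < mixture u.
Proof.
move=> mt ku; rewrite mixtureE /mean (bigD1 t) //= ltr_pwDl ?mulr_gt0 //.
by rewrite sumr_ge0 // => v _; rewrite mulr_ge0 ?dist_ge0.
Qed.

Lemma mixture_posE u : 0 < mixture u -> exists2 t, 0 < m t & 0 < k t u.
Proof.
rewrite mixtureE => mu; suff /existsP[t /andP[]] : [exists t, (0 < m t) && (0 < k t u)].
  by exists t.
apply: contraLR mu => /existsPn h; rewrite -leNgt -(mean_cst m 0).
by apply: ler_mean => t mt; have := h t; rewrite mt /= leNgt.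
Qed.

End Mixture.
End Mean.

(** * Expected total reward of a finite Markov chain *)

Section Value.
Variables (R : realType) (S : finType) (P : S -> dist R S) (rho : S -> R).

(** The function [P^n rho]: mean reward at time [n] of the chain started at [s]. *)
Fixpoint step_reward (n : nat) (s : S) : R :=
  if n is n'.+1 then mean (P s) (step_reward n') else rho s.

Definition value (s : S) : \bar R :=
  (\sum_(0 <= n <oo) (step_reward n s)%:E)%E.

Hypothesis rho_ge0 : forall s, 0 <= rho s.

Lemma step_reward_ge0 n s : 0 <= step_reward n s.
Proof. by elim: n s => //= n IH s; exact: mean_ge0. Qed.

Lemma value_ge0 s : (0 <= value s)%E.
Proof. by apply: nneseries_ge0 => n _ _; rewrite lee_fin step_reward_ge0. Qed.

Lemma valueE s : value s = ((rho s)%:E + emean (P s) value)%E.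
Proof.
have J0 n t : (0 <= (step_reward n t)%:E)%E by rewrite lee_fin step_reward_ge0.
rewrite /value nneseries_recl //; congr (_ + _)%E.
rewrite -(nneseries_addn 1) //; under eq_eseriesr do
  rewrite addn1 /= -emean_EFin.
rewrite nneseries_sum; first by apply: eq_bigr => t _; rewrite nneseriesZl.
by move=> t n _; rewrite mule_ge0 ?lee_fin ?dist_ge0 ?step_reward_ge0.
Qed.

(** Every partial sum of the series stays below [v], by induction through the supersolution
    inequality. As [v] may be infinite, states can be left out by giving them the value [+oo]. *)
Lemma value_le (v : S -> \bar R) s : (forall s, 0 <= v s)%E ->
  (forall s, (rho s)%:E + emean (P s) v <= v s)%E -> (value s <= v s)%E.
Proof.
have J0 n t : (0 <= (step_reward n t)%:E)%E by rewrite lee_fin step_reward_ge0.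
move=> v0 vP; apply: lime_le; first exact: is_cvg_nneseries.
apply: nearW => n; elim: n s => [|n IH] s; first by rewrite big_nil.
rewrite big_nat_recl //=; apply: le_trans (vP s); rewrite leeD2l //.
under eq_bigr do rewrite -emean_EFin.
rewrite /emean exchange_big; apply: lee_sum => t _ /=.
rewrite -ge0_sume_distrr //; apply: lee_wpmul2l; last exact: IH.
by rewrite lee_fin dist_ge0.
Qed.

Definition barren (D : {set S}) : Prop :=
  forall s, s \in D -> rho s = 0 /\ forall t, 0 < P s t -> t \in D.

Lemma value_barren D s : barren D -> s \in D -> value s = 0%E.
Proof.
move=> bD sD; apply/eqP; rewrite eq_le value_ge0 andbT.
(* Being infinite off [D], [v] need only be checked on [D], which the chain never leaves. *)
pose v s : \bar R := if s \in D then 0%E else +oo%E.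
have <- : v s = 0%E by rewrite /v sD.
apply: value_le => t; first by rewrite /v; case: ifP.
rewrite {2}/v; case: ifP => tD; last exact: leey.
have [-> Dt] := bD _ tD; rewrite add0e.
rewrite (eq_emean (g := fun=> (0 : R)%:E)); first by rewrite emean_EFin mean_cst.
by move=> u /Dt uD; rewrite /v uD.
Qed.

Hypothesis value_fin : forall s, (value s < +oo)%E.

Lemma value_fineK s : (fine (value s))%:E = value s.
Proof. by rewrite fineK // ge0_fin_numE ?value_ge0. Qed.

Lemma fine_valueE s :
  fine (value s) = rho s + mean (P s) (fun t => fine (value t)).
Proof.
apply: EFin_inj; rewrite EFinD -emean_EFin value_fineK valueE; congr (_ + _)%E.
by apply: eq_emean => t _; rewrite value_fineK.
Qed.

Lemma fine_value_le (v : S -> R) s : (forall s, 0 <= v s) ->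
  (forall s, rho s + mean (P s) v <= v s) -> fine (value s) <= v s.
Proof.
move=> v0 vP; rewrite -lee_fin value_fineK.
by apply: (value_le (v := fun s => (v s)%:E)) => t; rewrite ?lee_fin ?emean_EFin -?EFinD ?lee_fin.
Qed.

(* Where x - value is maximal the chain stays, and inside that set it stays
   where the value is minimal; on the latter set it earns nothing, so the
   value vanishes and x is constant. *)
Lemma value_ge (x : S -> R) :
  (forall s, x s <= rho s + mean (P s) x) ->
  (forall D c, 0 < c -> barren D -> (forall s, s \in D -> x s = c) -> D = finset.set0) ->
  forall s, x s <= fine (value s).
Proof.
move=> xP no_barren s0; have [e e_def] : exists e, forall s, e s = fine (value s).
  by exists (fun s => fine (value s)).
have eE s : e s = rho s + mean (P s) e.
  by rewrite e_def fine_valueE; congr (_ + _); apply: eq_mean => t _.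
rewrite leNgt; apply/negP => xe0.
have [w w_def] : exists w, forall s, w s = x s - e s by exists (fun s => x s - e s).
have [s1 _ s1max] : exists2 s1 : S, true & forall s, w s <= w s1.
  by case: (arg_maxP (P := predT) (i0 := s0) w) => // s1 _ h; exists s1 => // s; exact: h.
have [M M_def] : exists M, M = w s1 by exists (w s1).
rewrite -M_def in s1max.
have M0 : 0 < M by apply: lt_le_trans (s1max s0); rewrite w_def subr_gt0 e_def.
have wP s : w s <= mean (P s) w.
  have -> : mean (P s) w = mean (P s) x - mean (P s) e.
    by rewrite -meanB; apply: eq_mean => t _.
  by rewrite w_def eE; have := xP s; lra.
have [s2 ws2 s2min] : exists2 s2 : S, w s2 == M & forall s, w s == M -> e s2 <= e s.
  by case: (arg_minP (P := fun s => w s == M) (i0 := s1) e) => [|s2 h k]; [exact/eqP|]; exists s2.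
pose D := [set s | (w s == M) && (e s == e s2)]%SET.
have wstay s : w s == M -> forall t, 0 < P s t -> w t == M.
  move=> /eqP ws t Pt; apply/eqP.
  apply: (mean_le_eq (m := P s) (f := w) (g := fun=> M)) => [u _|//|//]; first exact: s1max.
  by rewrite mean_cst -ws.
have bD : barren D.
  move=> s; rewrite inE => /andP[ws /eqP es].
  have le : e s2 <= mean (P s) e.
    rewrite -[leLHS](mean_cst (P s)); apply: ler_mean => t Pt.
    exact/s2min/(wstay s).
  have rho0 : rho s = 0 by have := rho_ge0 s; have := eE s; lra.
  split=> // t Pt; rewrite inE (wstay s) //=; apply/eqP/esym.
  apply: (mean_le_eq (m := P s) (f := fun=> e s2) _ _ Pt) => [u Pu|].
    exact/s2min/(wstay s).
  by rewrite mean_cst -es (eE s) rho0 add0r.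
(* On [D] the value is 0, so [x] equals the positive constant [M] there. *)
have D0 : D = finset.set0.
  apply: (no_barren D M M0 bD) => s sD; have := value_barren bD sD.
  by move: sD; rewrite inE w_def e_def => /andP[/eqP <- _] ->; rewrite subr0.
by have : s2 \in D; [rewrite inE ws2 eqxx | rewrite D0 inE].
Qed.

End Value.

(** * One-coordinate marginals of the path measure *)

Section ChainMarginals.
Variables (R : realType) (X : finType) (m : dist R X) (k : X -> dist R X).

Fixpoint mean_at (n : nat) (m' : dist R X) (h : X -> R) : R :=
  if n is n'.+1 then mean m' (fun x => mean_at n' (k x) h) else mean m' h.

Lemma mean_at_sum n m' h :
  mean_at n m' h = \sum_x h x * mean_at n m' (fun y => (y == x)%:R).
Proof.
elim: n m' => [|n IH] m' /=.
  apply: eq_bigr => x _; rewrite mulrC; congr (_ * _).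
  rewrite /mean (bigD1 x) //= eqxx mulr1 big1 ?addr0 // => y /negbTE ->.
  by rewrite mulr0.
transitivity (\sum_y \sum_x m' y * (h x * mean_at n (k y) (fun z => (z == x)%:R))).
  by apply: eq_bigr => y _; rewrite IH mulr_sumr.
rewrite exchange_big; apply: eq_bigr => x _; rewrite mulr_sumr.
by apply: eq_bigr => y _; rewrite mulrCA.
Qed.

(** Conditional law of the letter that follows the word [w]. *)
Fixpoint next_law (m' : dist R X) (w : seq X) : dist R X :=
  if w is x :: w' then next_law (k x) w' else m'.

Lemma word_prob_rcons m' w x :
  word_prob m' k (rcons w x) = word_prob m' k w * next_law m' w x.
Proof. by elim: w m' => [|y w IH] m' /=; rewrite ?mulr1 ?mul1r // IH mulrA. Qed.

Lemma next_law_rcons m' w x : next_law m' (rcons w x) = k x.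
Proof. by elim: w m' => /=. Qed.

Let after w n x : set (paths m) :=
  (cylinder w `&` [set o | o (size w + n)%N = x])%classic.

Let cylinder_rcons w x (o : nat -> X) :
  cylinder (rcons w x) o <-> cylinder w o /\ o (size w) = x.
Proof.
rewrite /cylinder /= size_rcons mkseqS; split => [/eqP|[-> ->] //].
by rewrite eqseq_rcons => /andP[/eqP ? /eqP].
Qed.

Let after0 w x : after w 0 x = cylinder (rcons w x).
Proof.
by apply/seteqP; split => o /=; rewrite cylinder_rcons /after /= addn0.
Qed.

Let afterS w n x : after w n.+1 x = (\bigcup_(y in setT) after (rcons w y) n x)%classic.
Proof.
apply/seteqP; split => o /=.
  move=> [wo ox]; exists (o (size w)) => //; split; first exact/cylinder_rcons.
  by rewrite /= size_rcons addSnnS.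
move=> [y _ [/cylinder_rcons[wo _] ox]]; split=> //.
by move: ox; rewrite /= size_rcons addSnnS.
Qed.

Lemma measurable_cylinder w : measurable (cylinder w : set (paths m)).
Proof. by apply: sub_sigma_algebra; exists w. Qed.

Let measurable_after w n x : measurable (after w n x).
Proof.
elim: n w => [|n IH] w; first by rewrite after0; exact: measurable_cylinder.
by rewrite afterS; apply: fin_bigcup_measurable => //; exact: finite_finset.
Qed.

(** Induction on [n]: the event splits, by the first letter after [w], into disjoint events of the
    same kind, down to cylinders, whose measure is known. *)
Let chain_after w n x : chain_measure m k (after w n x) =
  (word_prob m k w * mean_at n (next_law m w) (fun y => (y == x)%:R))%:E.
Proof.
elim: n w => [|n IH] w.
  rewrite after0 chain_measureE word_prob_rcons /= /mean (bigD1 x) //= eqxx mulr1.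
  by rewrite big1 ?addr0 // => y /negbTE ->; rewrite mulr0.
have tI : trivIset setT (fun y => after (rcons w y) n x).
  by move=> y z _ _ [p [[/cylinder_rcons[_ <-] _] [/cylinder_rcons[_ <-] _]]].
rewrite afterS (measure_fin_bigcup _ finite_finset tI) // (fsbigE _ _ (index_enum_uniq X)) //; last first.
  by move=> y _; rewrite mem_index_enum.
transitivity (\sum_(y : X)
    (word_prob m k w * (next_law m w y * mean_at n (k y) (fun z => (z == x)%:R)))%:E)%E.
  rewrite big_mkcond; apply: eq_bigr => y _; rewrite in_setT.
  by apply: etrans (IH _) _; rewrite word_prob_rcons next_law_rcons mulrA.
by rewrite sumEFin -mulr_sumr.
Qed.

Let at_indic (h : X -> R) n (o : paths m) :
  h (o n) = \sum_x h x * \1_(after [::] n x) o.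
Proof.
have afterP x : (o \in after [::] n x) = (o n == x).
  by apply/idP/eqP => [/set_mem[] //|<-]; apply/mem_set.
rewrite (bigD1 (o n)) //= indicE afterP eqxx mulr1 big1 ?addr0 // => x xo.
by rewrite indicE afterP eq_sym (negbTE xo) mulr0.
Qed.

Lemma measurable_at (h : X -> R) n :
  measurable_fun setT (fun o : paths m => (h (o n))%:E).
Proof.
apply/measurable_EFinP; rewrite (_ : (fun o : paths m => h (o n)) =
    fun o => \sum_x h x * \1_(after [::] n x) o).
  by apply: measurable_sum => x; apply: measurable_funM => //; exact: measurable_indic.
by apply/funext => o; rewrite at_indic.
Qed.

(** By [at_indic], the integrand is a finite combination of indicators of events measured by
    [chain_after]. *)
Lemma integral_at (h : X -> R) n : (forall x, 0 <= h x) ->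
  (\int[chain_measure m k]_o (h (o n))%:E)%E = (mean_at n m h)%:E.
Proof.
move=> h0; under eq_integral do rewrite at_indic -sumEFin.
rewrite ge0_integral_sum //.
- rewrite mean_at_sum -sumEFin; apply: eq_bigr => x _.
  under eq_integral do rewrite EFinM.
  rewrite ge0_integralZl_EFin ?integral_indic ?setIT //.
    rewrite EFinM; congr (_ * _)%E.
    by apply: etrans (chain_after _ _ _) _; rewrite mul1r.
  by apply/measurable_EFinP/measurable_indic.
- move=> x; apply/measurable_EFinP; apply: measurable_funM => //.
- by move=> x o _; rewrite lee_fin mulr_ge0 // indicE.
Qed.

End ChainMarginals.

(** * Expected rewards of the game as values of Markov chains on its states *)

Section ExpectedReward.
Variables (R : realType) (Sc Se A : finType) (G : game Sc Se A).
Variables (sigma : strategy R G) (pi : env_strategy R G).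
Variable rw : Sc + Se -> A -> R.
Hypothesis rw_ge0 : forall s a, 0 <= rw s a.

Let law := action_law sigma pi.
Let trans s := mixture (law s) (succ_law R G s).
Let gain s := mean (law s) (rw s).

(** Given the state, the action is drawn afresh, so the chain of state-action pairs projects to a
    chain of states with kernel [trans] and one-step reward [gain]. *)
Lemma mean_at_compose n (m : dist R (Sc + Se)%type) :
  mean_at (next_step sigma pi) n (compose_dist m law) (fun x => rw x.1 x.2) =
  mean m (step_reward trans gain n).
Proof.
have mean_compose (f : (Sc + Se) * A -> R) m' :
    mean (compose_dist m' law) f = mean m' (fun s => mean (law s) (fun a => f (s, a))).
  rewrite /mean.
  transitivity (\sum_x m' x.1 * law x.1 x.2 * f (x.1, x.2)).
    by apply: eq_bigr => -[s a] _; rewrite ffunE.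
  rewrite -(pair_bigA _ (fun s a => m' s * law s a * f (s, a))) /=.
  by apply: eq_bigr => s _; rewrite mulr_sumr; apply: eq_bigr => a _; rewrite mulrA.
elim: n m => [|n IH] m /=; rewrite mean_compose; apply: eq_mean => s _ //=.
by rewrite mean_mixture; apply: eq_mean => a _; rewrite IH.
Qed.

(** Nonnegativity lets the integral pass through the series; each term is then a marginal. This
    replaces path measures by the fixed-point calculus of [value]. *)
Lemma expected_reward_value s :
  expected_reward sigma pi s rw = value trans gain s.
Proof.
rewrite /expected_reward /total_reward integral_nneseries //.
- apply: eq_eseriesr => n _.
  rewrite (integral_at _ _ (h := fun x => rw x.1 x.2)) //.
  by rewrite mean_at_compose mean_dirac.
- by move=> n; exact: (@measurable_at _ _ _ (fun x => rw x.1 x.2) n).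
- by move=> n o _; rewrite lee_fin.
Qed.

End ExpectedReward.

(** * The two-point argument in the plane *)

Section TwoPoint.
Variables (R : realType) (T : finType).
Implicit Types (m : dist R T) (f l u : T -> R).

Lemma dist2_ex p q (a : R) : 0 < a -> a <= 1 -> exists m,
  [/\ (forall f, mean m f = a * f p + (1 - a) * f q), 0 < m p
    & supp m \subset [set p; q]%SET].
Proof.
move=> a0 a1; have a2 : 0 <= 1 - a by rewrite subr_ge0.
pose g := [ffun t => a * (t == p)%:R + (1 - a) * (t == q)%:R].
have gE f : \sum_t g t * f t = a * f p + (1 - a) * f q.
  under eq_bigr do rewrite ffunE mulrDl.
  rewrite big_split /=; congr (_ + _).
    rewrite (bigD1 p) //= eqxx mulr1 big1 ?addr0 // => t /negbTE ->.
    by rewrite mulr0 mul0r.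
  rewrite (bigD1 q) //= eqxx mulr1 big1 ?addr0 // => t /negbTE ->.
  by rewrite mulr0 mul0r.
have g0 t : 0 <= g t by rewrite ffunE addr_ge0 ?mulr_ge0 ?ler0n ?(ltW a0).
have g1 : \sum_t g t = 1.
  by have := gE (fun=> 1); under eq_bigr do rewrite mulr1; move=> ->; ring.
exists (Dist g0 g1); split=> //=.
  by rewrite ffunE eqxx mulr1 ltr_pwDl ?mulr_ge0.
apply/fintype.subsetP => t; rewrite !inE /= ffunE.
by case: eqP; case: eqP => //=; rewrite !mulr0 addr0 ltxx.
Qed.

Lemma balance_ex m u p q : 0 < m p -> 0 < m q -> u q < mean m u < u p ->
  exists m' a, 0 < a < 1 /\ [/\ (forall f, mean m' f = a * f p + (1 - a) * f q),
    mean m' u = mean m u, 0 < m' p,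
    (#|supp m'| <= 2)%N & forall t, 0 < m' t -> 0 < m t].
Proof.
move=> mp mq /andP[uq up]; set U := mean m u in uq up *.
(* This weight makes the [u]-average of [p] and [q] equal to [U]. *)
pose a := (U - u q) / (u p - u q).
have a0 : 0 < a by rewrite divr_gt0 ?subr_gt0 // (lt_trans uq up).
have a1 : a < 1 by rewrite ltr_pdivrMr ?subr_gt0 ?(lt_trans uq up) // mul1r ltrD2r.
have [m' [mE m'p m'pq]] := dist2_ex p q a0 (ltW a1).
exists m', a; rewrite a0 a1; do 2!split=> //; rewrite ?mE //.
- by rewrite /a; field; rewrite subr_eq0 gt_eqF // (lt_trans uq up).
- by apply: leq_trans (subset_leq_card m'pq) _; rewrite cards2; case: (p != q).
- move=> t m't; have : t \in supp m' by rewrite inE.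
  by move/(fintype.subsetP m'pq); rewrite !inE => /orP[]/eqP->.
Qed.

Let dirac_ex m l u x p : 0 < m p -> x <= l p -> u p <= mean m u -> exists m',
  [/\ (forall t, 0 < m' t -> 0 < m t), (#|supp m'| <= 2)%N, x <= mean m' l,
      mean m' u <= mean m u & 0 < m' p].
Proof.
move=> mp xp up; exists (dirac_dist R p); rewrite !mean_dirac dirac_pos eqxx; split=> //.
  by move=> t; rewrite dirac_pos => /eqP->.
apply: (@leq_trans #|[set p]%SET|); last by rewrite cards1.
by apply/subset_leq_card/fintype.subsetP => t; rewrite !inE dirac_pos.
Qed.

(* Let p be the point (l t, u t) of least slope, seen from (x, mean m u), among
   those with l t > x. Some other point q lies under the line through these two
   points and below height mean m u; the chord from p to q crosses that height
   to the right of x. *)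
Lemma two_point m l u x t0 : x <= mean m l -> 0 < m t0 -> exists m',
  [/\ (forall t, 0 < m' t -> 0 < m t), (#|supp m'| <= 2)%N, x <= mean m' l,
      mean m' u <= mean m u & (exists2 t, 0 < m' t & x < l t) \/ 0 < m' t0].
Proof.
move=> xl mt0; set U := mean m u.
case: (boolP [exists t, (0 < m t) && (x < l t)])
  => [/existsP[p0 /andP[mp0 xp0]]|/existsPn h].
  (* A point to the right of [x] and not above [U] would do alone; otherwise all points to the right
     lie above [U]. *)
  case: (boolP [exists t, [&& 0 < m t, x < l t & u t <= U]])
    => [/existsP[p /and3P[mp xp pU]]|/existsPn hU].
    have [m' [h1 h2 h3 h4 m'p]] := dirac_ex mp (ltW xp) pU.
    by exists m'; split=> //; left; exists p.
  have posU t : 0 < m t -> x < l t -> U < u t.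
    by move=> mt lt; have := hU t; rewrite mt lt /= ltNge.
  pose slope t := (u t - U) / (l t - x).
  have [p /andP[mp xp] pmin] : exists2 p, (0 < m p) && (x < l p) &
      forall t, (0 < m t) && (x < l t) -> slope p <= slope t.
    case: (arg_minP (P := fun t => (0 < m t) && (x < l t)) (i0 := p0) slope).
      by rewrite mp0 xp0.
    by move=> p h k; exists p.
  have pU := posU p mp xp.
  have [k [k0 kE]] : exists k, 0 < k /\ u p - U = k * (l p - x).
    exists (slope p); rewrite divr_gt0 ?subr_gt0 //; split=> //.
    by rewrite /slope divfK // subr_eq0 gt_eqF.
  have k_ge t : 0 < m t -> x < l t -> 0 <= (u t - U) - k * (l t - x).
    move=> mt xt; rewrite subr_ge0 -ler_pdivlMr ?subr_gt0 //.
    have -> : k = slope p by rewrite /slope kE mulfK // subr_eq0 gt_eqF.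
    by apply: pmin; rewrite mt.
  pose good t := [&& 0 < m t, l t <= x, u t < U & u t - U <= k * (l t - x)].
  case: (boolP [exists t, good t]) => [/existsP[q /and4P[mq qx qU qk]]|/existsPn hq].
    have [|m' [a [/andP[a0 a1] [mE m'u m'p m'2 m'm]]]] := @balance_ex m u p q mp mq.
      by rewrite qU.
    exists m'; split=> //; rewrite ?m'u //; last by left; exists p.
    rewrite mE; have := m'u; rewrite mE -/U => e.
    rewrite -subr_ge0 -(pmulr_rge0 _ k0).
    have : (1 - a) * (u q - U) <= (1 - a) * (k * (l q - x)).
      by rewrite ler_pM2l // subr_gt0.
    have : a * (u p - U) = a * (k * (l p - x)) by rewrite kE.
    nra.
  (* Without such a [q] no point lies under the line, on which [v] is 0, while the mean of [v] is at
     most 0. So all points lie on the line, hence none is below [U], and [u p > U] contradicts the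
     mean. *)
  exfalso.
  pose v t := (u t - U) - k * (l t - x).
  have v0 t : 0 < m t -> 0 <= v t.
    move=> mt; case: (ltP x (l t)) => xt; first exact: k_ge.
    have := hq t; rewrite /good mt xt /= negb_and -!ltNge -leNgt /v.
    case/orP=> [h|h]; last by rewrite subr_ge0 ltW.
    have : k * (l t - x) <= 0 by rewrite pmulr_rle0 // subr_le0.
    by lra.
  have mv : mean m v <= 0.
    rewrite meanB meanB mean_cst meanZ meanB mean_cst -/U.
    by have : 0 <= k * (mean m l - x); [rewrite mulr_ge0 ?subr_ge0 ?(ltW k0)|lra].
  have v00 t : 0 < m t -> v t = 0.
    move=> mt; apply/esym.
    by apply: (mean_le_eq (m := m) (f := fun=> 0) _ _ mt); rewrite ?mean_cst.
  have u0 t : 0 < m t -> 0 <= u t - U.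
    move=> mt; case: (ltP x (l t)) => xt; first by rewrite subr_ge0 ltW // posU.
    have := hq t; rewrite /good mt xt /= negb_and -!ltNge -leNgt.
    by have := v00 t mt; rewrite /v => ? /orP[]; lra.
  have : 0 = u p - U.
    apply: (mean_le_eq (m := m) (f := fun=> 0) (g := fun t => u t - U) _ _ mp) => //.
    by rewrite mean_cst meanB mean_cst subrr.
  lra.
(* No point is to the right of [x], so [l] is [x] throughout and only heights have to be balanced,
   with [t0] kept. *)
have lx t : 0 < m t -> l t = x.
  move=> mt; apply: (mean_le_eq (m := m) (g := fun=> x) _ _ mt); rewrite ?mean_cst //.
  by move=> s ms; have := h s; rewrite ms /= -leNgt.
case: (lerP (u t0) U) => t0U.
  have [|m' [h1 h2 h3 h4 m't0]] := @dirac_ex m l u x t0 mt0 _ t0U; first by rewrite lx.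
  by exists m'; split=> //; right.
have [q mq qU] : exists2 q, 0 < m q & u q < U.
  suff /existsP[q /andP[]] : [exists q, (0 < m q) && (u q < U)] by exists q.
  rewrite -[X in is_true X]negbK; apply/negP => /existsPn h'.
  have : U = u t0.
    apply: (mean_le_eq (m := m) (f := fun=> U) _ _ mt0); rewrite ?mean_cst //.
    by move=> s ms; have := h' s; rewrite ms /= -leNgt.
  by lra.
have [|m' [a [/andP[a0 a1] [mE m'u m'p m'2 m'm]]]] := @balance_ex m u t0 q mt0 mq.
  by rewrite qU.
exists m'; split=> //; rewrite ?m'u //; last by right.
by rewrite mE !lx // -mulrDl addrC subrK mul1r.
Qed.

End TwoPoint.

(* A decision process where, in state s, a set B of actions is drawn from w s
   and then an action of B is chosen; kap s a is the law of the next state. *)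
Section DecisionProcess.
Variables (R : realType) (S A : finType) (kap : S -> A -> dist R S).
Implicit Types (rw : S -> A -> R) (law : S -> dist R A) (x y : S -> R).

Definition policy_trans law s := mixture (law s) (kap s).

Definition policy_value rw law : S -> \bar R :=
  value (policy_trans law) (fun s => mean (law s) (rw s)).

Definition action_value rw x s a : R := rw s a + mean (kap s a) x.

Lemma mean_action_value rw law x s :
  mean (law s) (action_value rw x s) =
  mean (law s) (rw s) + mean (policy_trans law s) x.
Proof. by rewrite meanD mean_mixture. Qed.

Lemma policy_gain_ge0 rw law : (forall s a, 0 <= rw s a) ->
  forall s, 0 <= mean (law s) (rw s).
Proof. by move=> rw0 s; apply: mean_ge0. Qed.

(** * Optimal deterministic selectors when all values are finite *)

Section Selectors.
Variable w : S -> dist R {set A}.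
Hypothesis w_ne : forall s B, 0 < w s B -> B != finset.set0.
Variable a0 : A.
Implicit Types h : S -> {set A} -> A.

Definition valid h := forall s B, 0 < w s B -> h s B \in B.

Definition sel_law h s : dist R A := mixture (w s) (fun B => dirac_dist R (h s B)).

Lemma mean_sel_law h s f : mean (sel_law h s) f = mean (w s) (fun B => f (h s B)).
Proof. by rewrite mean_mixture; apply: eq_mean => B _; rewrite mean_dirac. Qed.

Lemma sel_law_pos h s B : 0 < w s B -> 0 < sel_law h s (h s B).
Proof. by move=> wB; apply: (mixture_pos wB); rewrite dirac_pos. Qed.

Lemma greedy_ex (f : S -> A -> R) : exists h, forall s (B : {set A}),
  B != finset.set0 -> h s B \in B /\ forall a, a \in B -> f s (h s B) <= f s a.
Proof.
have g s (B : {set A}) : exists a, B != finset.set0 ->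
    a \in B /\ forall b, b \in B -> f s a <= f s b.
  have [->|/set0Pn[a aB]] := eqVneq B finset.set0; first by exists a0.
  by case: (arg_minP (P := mem B) (f s) aB) => b bB bmin; exists b.
exists (fun s B => projT1 (cid (g s B))) => s B; by case: cid.
Qed.

Lemma valid_ex : exists h, valid h.
Proof.
have [h hP] := greedy_ex (fun _ _ => 0).
by exists h => s B /w_ne/(hP s)[].
Qed.

(** There are finitely many selectors, as the encoding by finite functions shows. *)
Lemma valid_argmin (F : (S -> {set A} -> A) -> R) :
  exists2 h, valid h & forall h', valid h' -> F h <= F h'.
Proof.
pose tofun (g : {ffun S * {set A} -> A}) s B := g (s, B).
pose P g := `[< valid (tofun g) >].
have ofP h : tofun [ffun p => h p.1 p.2] = h.
  by apply/funext => s; apply/funext => B; rewrite /tofun ffunE.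
have [h0 h0v] := valid_ex.
case: (arg_minP (P := P) (i0 := [ffun p => h0 p.1 p.2]) (F \o tofun)).
  by apply/asboolP; rewrite ofP.
move=> g /asboolP gv gmin; exists (tofun g) => // h' h'v.
by have := gmin [ffun p => h' p.1 p.2]; rewrite /= ofP; apply; apply/asboolP; rewrite ofP.
Qed.

Variable rw : S -> A -> R.
Hypothesis rw_ge0 : forall s a, 0 <= rw s a.
Let V h := policy_value rw (sel_law h).
Let q := action_value rw.
Hypothesis V_fin : forall h, valid h -> forall s, (V h s < +oo)%E.

Let gain_ge0 law : forall s, 0 <= mean (law s) (rw s).
Proof. exact: policy_gain_ge0. Qed.

(** A minimiser of the sum of the values works: switching to [h'] where [v] is smaller gives a
    selector whose value is at most the pointwise minimum of [x] and [v], and minimality of the sum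
    makes this minimum equal to [x]. *)
Lemma min_selector : exists2 h, valid h & forall h' v, valid h' -> (forall s, 0 <= v s) ->
  (forall s, mean (w s) (fun B => q v s (h' s B)) <= v s) ->
  forall s, fine (V h s) <= v s.
Proof.
have [h hv hmin] := valid_argmin (fun h => \sum_s fine (V h s)).
exists h => // h' v h'v v0 vP s.
pose x s := fine (V h s).
have xE t : x t = mean (w t) (fun B => q x t (h t B)).
  by rewrite -mean_sel_law mean_action_value /x {1}/V /policy_value fine_valueE //; exact: V_fin.
have x0 t : 0 <= x t by rewrite fine_ge0 // value_ge0.
pose g t := if v t < x t then h' t else h t.
have gv : valid g by move=> t B wB; rewrite /g; case: ifP => _; [exact: h'v|exact: hv].
pose u t := Num.min (x t) (v t).
have gu t : fine (V g t) <= u t.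
  apply: fine_value_le; [exact: gain_ge0|exact: V_fin|..].
    by move=> {}t; rewrite le_min x0 v0.
  move=> {}t; rewrite -mean_action_value mean_sel_law /g /u.
  case: ltP => vx.
    apply: le_trans (vP t); apply: ler_mean => B _.
    by rewrite lerD2l; apply: ler_mean => r _; rewrite ge_min lexx orbT.
  rewrite (xE t); apply: ler_mean => B _.
  by rewrite lerD2l; apply: ler_mean => r _; rewrite ge_min lexx.
have ux : forall t, u t = x t.
  have ux' t : u t <= x t by rewrite ge_min lexx.
  have : \sum_t (x t - u t) <= 0.
    rewrite sumrB subr_le0; apply: le_trans (hmin g gv) _.
    exact: ler_sum.
  move=> le0 t; apply/esym/eqP; rewrite -subr_eq0; apply/eqP.
  apply: (@psumr_eq0P _ _ predT (fun t => x t - u t)) => //.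
    by move=> r _; rewrite subr_ge0.
  by apply/eqP; rewrite eq_le le0 sumr_ge0 // => r _; rewrite subr_ge0.
by have := ux s; rewrite /u => /eqP; rewrite eq_minl.
Qed.

(** Policy improvement: let [h] maximise the sum of the values. If [c] were better for one step at
    [s0], switching to it there would lower no value and raise the one at [s0]. *)
Lemma max_selector : exists2 h, valid h & forall s (c : {set A} -> A),
  (forall B, 0 < w s B -> c B \in B) ->
  mean (w s) (fun B => q (fun s => fine (V h s)) s (c B)) <= fine (V h s).
Proof.
have [h hv hmin] := valid_argmin (fun h => - \sum_s fine (V h s)).
exists h => // s0 c cv; rewrite leNgt; apply/negP => improve.
pose h' t := if t == s0 then c else h t.
have h'v : valid h'.
  by move=> t B wB; rewrite /h'; case: eqP => [e|_]; [rewrite e in wB; exact: cv|exact: hv].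
pose y s := fine (V h s); pose y' s := fine (V h' s).
have yE t : y t = mean (w t) (fun B => q y t (h t B)).
  by rewrite -mean_sel_law mean_action_value /y {1}/V /policy_value fine_valueE //; exact: V_fin.
have y'E t : y' t = mean (w t) (fun B => q y' t (h' t B)).
  by rewrite -mean_sel_law mean_action_value /y' {1}/V /policy_value fine_valueE //; exact: V_fin.
have lawE t : t != s0 -> sel_law h' t = sel_law h t.
  by rewrite /sel_law /h' => /negbTE ->.
have yy' t : y t <= y' t.
  apply: value_ge => {t}; [exact: gain_ge0|exact: V_fin|..].
    move=> t; rewrite -mean_action_value mean_sel_law.
    have [->|ts] := eqVneq t s0; first by rewrite /h' eqxx ltW.
    by rewrite {1}yE /h' (negbTE ts).
  (* A trap for [h'] cannot contain [s0], since [c] would gain nothing there; so it is a trap for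
     [h] too, and [y] vanishes on it. *)
  move=> D M M0 bD yM; have s0D : s0 \notin D.
    apply/negP => sD; have [g0 Dt] := bD _ sD; move: improve.
    have -> : mean (w s0) (fun B => q y s0 (c B)) = mean (sel_law h' s0) (q y s0).
      by rewrite mean_sel_law /h' eqxx.
    rewrite mean_action_value g0 add0r -/(y s0) yM //.
    by rewrite (eq_mean (g := fun=> M)) ?mean_cst ?ltxx // => t /Dt; exact: yM.
  have bD' : barren (policy_trans (sel_law h)) (fun s => mean (sel_law h s) (rw s)) D.
    move=> t tD; have := bD t tD; rewrite /policy_trans lawE //.
    by apply: contraNneq s0D => <-.
  apply/eqP; rewrite -[_ == _]negbK; apply/negP => /set0Pn[t tD].
  have := yM t tD; rewrite /y /V /policy_value (value_barren _ bD') //=.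
  by move=> M0'; rewrite -M0' ltxx in M0.
have lt0 : y s0 < y' s0.
  apply: lt_le_trans improve _; rewrite y'E /h' eqxx; apply: ler_mean => B _.
  by rewrite lerD2l; apply: ler_mean => t _; exact: yy'.
have := hmin h' h'v; rewrite lerN2 leNgt => /negP; apply.
by rewrite (bigD1 s0) //= [ltRHS](bigD1 s0) //= ltr_leD // ler_sum // => t _; exact: yy'.
Qed.

End Selectors.
End DecisionProcess.

(** * Optimal selectors when values may be infinite *)

Section FiniteStates.
Variables (R : realType) (S A : finType) (kap : S -> A -> dist R S).
Variable w : S -> dist R {set A}.
Hypothesis w_ne : forall s B, 0 < w s B -> B != finset.set0.
Variable a0 : A.
Variable rw : S -> A -> R.
Hypothesis rw_ge0 : forall s a, 0 <= rw s a.

Let V h := policy_value kap rw (sel_law w h).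

Let gain_ge0 law : forall s, 0 <= mean (law s) (rw s).
Proof. exact: policy_gain_ge0. Qed.

Let V_ge0 h s : (0 <= V h s)%E.
Proof. exact: value_ge0. Qed.

Definition finite_states : {set S} :=
  [set s | `[< forall h, valid w h -> (V h s < +oo)%E >]]%SET.

(* If the selectors h and h' agree off s, then a run under h collects at most
   what h' collects before reaching s, plus the value of h at s. *)
Lemma finite_states_closed s B a t : s \in finite_states ->
  0 < w s B -> a \in B -> 0 < kap s a t -> t \in finite_states.
Proof.
rewrite !inE => /asboolP sfin wB aB kt; apply/asboolP => h hv.
(* Forcing [a] makes [t] reachable in one step from [s], so that [V h' t] is finite because [V h' s]
   is. *)
pose h' u C := if (u == s) && (C == B) then a else h u C.
have h'v : valid w h'.
  move=> u C wC; rewrite /h'; case: ifP => [/andP[_ /eqP->] //|_]; exact: hv.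
have Vs := sfin h hv.
have V't : (V h' t < +oo)%E.
  have := sfin h' h'v; rewrite {1}/V /policy_value valueE // => le.
  have Pt : 0 < policy_trans kap (sel_law w h') s t.
    apply: mixture_pos kt; have := sel_law_pos h' wB.
    by rewrite /h' !eqxx.
  rewrite ltey; apply/negP => /eqP V't; move: le; rewrite ltNge => /negP; apply.
  have := lee_emean_pos (policy_trans kap (sel_law w h') s) t (V_ge0 h').
  rewrite V't gt0_muley ?lte_fin // leye_eq => /eqP.
  by rewrite -/(V h') /V => ->; rewrite addey.
(* A supersolution for [h]: at [s] the minimum is [V h s], and elsewhere [h] and [h'] have the same
   law. *)
pose v u : \bar R := mine (V h u) (V h' u + V h s)%E.
have : (V h t <= v t)%E.
  apply: value_le => [|u|u]; first exact: gain_ge0.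
    by rewrite le_min V_ge0 adde_ge0.
  have vV : ((mean (sel_law w h u) (rw u))%:E +
      emean (policy_trans kap (sel_law w h) u) v <= V h u)%E.
    rewrite [leRHS]valueE //; apply: leeD2l; apply: lee_emean => r _.
    by rewrite ge_min lexx.
  rewrite le_min vV /=; have [us|us] := eqVneq u s.
    by apply: le_trans vV _; rewrite us leeDr.
  have lawE : sel_law w h u = sel_law w h' u.
    by rewrite /sel_law /h' (negbTE us).
  rewrite [V h' u]valueE // -addeA /policy_trans lawE leeD2l //.
  rewrite -[X in (_ + X)%E](emean_cst (mixture (sel_law w h' u) (kap u))) //.
  apply: (@le_trans _ _ (emean (mixture (sel_law w h' u) (kap u))
    (fun r => V h' r + V h s)%E)); last by rewrite emeanD.
  by apply: lee_emean => r _; rewrite ge_min lexx orbT.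
move/le_lt_trans; apply; rewrite gt_min; apply/orP; right.
exact: lte_add_pinfty.
Qed.

(* Off the closed set of finite states the reward is dropped, which makes all
   values finite and does not change them on that set. *)
Lemma max_selector_finite : exists2 y : S -> R,
  (forall s, 0 <= y s) /\ (exists2 h, valid w h & forall s, ((y s)%:E <= V h s)%E) &
  forall s (c : {set A} -> A), s \in finite_states ->
    (forall B, 0 < w s B -> c B \in B) ->
    mean (w s) (fun B => action_value kap rw y s (c B)) <= y s.
Proof.
pose rw' s a := if s \in finite_states then rw s a else 0.
have rw'_ge0 s a : 0 <= rw' s a by rewrite /rw'; case: ifP.
pose V' h := policy_value kap rw' (sel_law w h).
have gain'_ge0 h s : 0 <= mean (sel_law w h s) (rw' s) by exact: policy_gain_ge0.
have finP s h : s \in finite_states -> valid w h -> (V h s < +oo)%E.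
  by rewrite inE => /asboolP; apply.
have V'_fin h : valid w h -> forall s, (V' h s < +oo)%E.
  (* Outside the finite states nothing is earned until the chain enters them, and [c] bounds the
     value from then on. *)
  move=> hv s; pose c : \bar R := (\sum_(t in finite_states) V h t)%E.
  have c0 : (0 <= c)%E by apply: sume_ge0.
  pose v t : \bar R := if t \in finite_states then V h t else c.
  have v0 t : (0 <= v t)%E by rewrite /v; case: ifP.
  apply: (@le_lt_trans _ _ (v s)); last first.
    rewrite /v; case: ifP => sf; first exact: finP.
    by apply: lte_sum_pinfty => t tf; exact: finP.
  apply: value_le => // t; rewrite {2}/v; case: ifP => tf.
    rewrite [leRHS]valueE //; apply: leeD.
      by rewrite lee_fin; apply: ler_mean => a _; rewrite /rw' tf.
    apply: lee_emean => u /mixture_posE[a /mixture_posE[B wB]].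
    rewrite dirac_pos => /eqP-> ku.
    by rewrite /v (finite_states_closed tf wB (hv _ _ wB) ku).
  rewrite (_ : mean _ _ = 0); last first.
    by rewrite -[RHS](mean_cst (sel_law w h t)); apply: eq_mean => a _; rewrite /rw' tf.
  rewrite add0e -[leRHS](emean_cst (policy_trans kap (sel_law w h) t)) //.
  apply: lee_emean => u _; rewrite /v; case: ifP => // uf.
  by rewrite /c (bigD1 u) //= leeDl // sume_ge0.
have [h hv hmax] := max_selector w_ne a0 rw'_ge0 V'_fin.
exists (fun s => fine (V' h s)).
  split=> [s|]; first by rewrite fine_ge0 // value_ge0.
  exists h => // s; rewrite value_fineK //; last exact: V'_fin.
  apply: value_le => // t; rewrite [leRHS]valueE //; apply: leeD2r.
  by rewrite lee_fin; apply: ler_mean => a _; rewrite /rw'; case: ifP.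
move=> s c sf cv; apply: le_trans (hmax s c cv); apply: ler_mean => B _.
by rewrite /action_value /rw' sf.
Qed.

End FiniteStates.

(** * Lower bound on the reward when fewer sets are used *)

Section RewardKept.
Variables (R : realType) (S A : finType) (kap : S -> A -> dist R S).
Variable w : S -> dist R {set A}.
Hypothesis w_ne : forall s B, 0 < w s B -> B != finset.set0.
Variable a0 : A.
Variable rw : S -> A -> R.
Hypothesis rw_ge0 : forall s a, 0 <= rw s a.
Let V h := policy_value kap rw (sel_law w h).
Hypothesis V_fin : forall h, valid w h -> forall s, (V h s < +oo)%E.

Let gain_ge0 law : forall s, 0 <= mean (law s) (rw s).
Proof. exact: policy_gain_ge0. Qed.

Definition progress s (B : {set A}) (X : {set S}) :=
  [forall a in B, (0 < rw s a) || [exists t in X, 0 < kap s a t]].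

Definition progress_step (X : {set S}) : {set S} :=
  [set s | [exists B : {set A}, (0 < w s B) && progress s B X]]%SET.

Lemma progress_step_mono : {homo progress_step : X Y / X \subset Y}.
Proof.
move=> X Y XY; apply/fintype.subsetP => s; rewrite !inE.
move=> /existsP[B /andP[wB pB]]; apply/existsP; exists B; rewrite wB /=.
apply/forall_inP => a /(forall_inP pB)/orP[->//|/exists_inP[t tX kt]].
by apply/orP; right; apply/exists_inP; exists t => //; exact: (fintype.subsetP XY).
Qed.

(** The states from which reward is earned with positive probability whatever is chosen inside the
    sets drawn. *)
Let W := fixset progress_step.

(** Each [bs s] with [s] in [W] is a set that put [s] into [W]. In [D], a state of least rank works:
    its actions earn, or may lead to a lower rank, hence out of [D]. *)
Lemma progress_choice : exists2 bs : S -> {set A}, forall s, 0 < w s (bs s) &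
  forall D : {set S}, D != finset.set0 -> D \subset W -> exists2 s, s \in D &
    forall a, a \in bs s -> 0 < rw s a \/ exists2 t, t \notin D & 0 < kap s a t.
Proof.
have mono := progress_step_mono.
pose rank := fix_order progress_step.
(* [s] first appears at iterate [rank s], so its set progresses into the iterate before; hence the
   [.-1]. *)
have bs s : exists B, 0 < w s B /\ (s \in W ->
    progress s B (iter (rank s).-1 progress_step finset.set0)).
  case: (boolP (s \in W)) => sW; last by have [B wB] := dist_pos (w s); exists B.
  have : s \in iter (rank s) progress_step finset.set0.
    by rewrite in_iter_fix_orderE.
  have : (0 < rank s)%N by rewrite fix_order_gt0.
  case: (rank s) => // n _; rewrite [iter _ _ _]/= inE => /existsP[B /andP[wB pB]].
  by exists B.
exists (fun s => projT1 (cid (bs s))) => [s|D /set0Pn[s0 s0D] DW].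
  by case: cid => B [].
case: (arg_minnP (P := mem D) rank s0D) => s sD smin; exists s => // a.
case: cid => B /= [wB] /(_ (fintype.subsetP DW _ sD)) pB.
move=> /(forall_inP pB)/orP[->|/exists_inP[t tX kt]]; first by left.
right; exists t => //; apply/negP => tD.
have := fix_order_small mono tX; rewrite leqNgt => /negP; apply.
have r0 : (0 < rank s)%N by rewrite fix_order_gt0 // (fintype.subsetP DW).
by rewrite (leq_trans _ (smin _ tD)) // prednK.
Qed.

(** The conditions on [w'] are what [two_point] provides. They keep [x] a subsolution and exclude
    the traps of [value_ge]. *)
Lemma reward_kept : exists x : S -> R, exists lam : S -> {set A} -> R,
  exists bs : S -> {set A},
  [/\ exists2 h, valid w h & forall s, V h s = (x s)%:E,
      forall s, x s <= mean (w s) (lam s),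
      forall s, 0 < w s (bs s) &
      forall w' : S -> dist R {set A}, (forall s B, 0 < w' s B -> 0 < w s B) ->
        (forall s, x s <= mean (w' s) (lam s)) ->
        (forall s, (exists2 B, 0 < w' s B & x s < lam s B) \/ 0 < w' s (bs s)) ->
      forall (law : S -> dist R A) (D : S -> {set A} -> dist R A),
        (forall s B a, 0 < w' s B -> 0 < D s B a -> a \in B) ->
        (forall s, law s = mixture (w' s) (D s)) ->
        (forall s, (policy_value kap rw law s < +oo)%E) ->
      forall s, ((x s)%:E <= policy_value kap rw law s)%E].
Proof.
have [h hv hmin] := min_selector w_ne a0 rw_ge0 V_fin.
pose x s := fine (V h s).
have xK s : V h s = (x s)%:E by rewrite /x value_fineK //; exact: V_fin.
have x0 s : 0 <= x s by rewrite fine_ge0 // value_ge0.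
have xE s : x s = mean (w s) (fun B => action_value kap rw x s (h s B)).
  rewrite -mean_sel_law mean_action_value /x {1}/V /policy_value fine_valueE //.
  exact: V_fin.
have [g gP] := greedy_ex a0 (action_value kap rw x).
have gv : valid w g by move=> s B /w_ne/(gP s)[].
have [bs bsw bsP] := progress_choice.
pose lam s B := action_value kap rw x s (g s B).
(* off W the minimiser can avoid all reward forever *)
have xW s : s \notin W -> x s = 0.
  have stay t (B : {set A}) : exists a, 0 < w t B -> t \notin W ->
      [/\ a \in B, rw t a = 0 & forall u, 0 < kap t a u -> u \notin W].
    case: (boolP ((0 < w t B) && (t \notin W))) => [/andP[wB tW]|]; last first.
      by rewrite negb_and => h'; exists a0 => wB tW; move: h'; rewrite wB tW.
    have : ~~ progress t B W.
      apply: contraNN tW => pB; rewrite /W -(fixsetK progress_step_mono) inE.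
      by apply/existsP; exists B; rewrite wB.
    move=> /forall_inPn[a aB]; rewrite negb_or -leNgt => /andP[rw0 /exists_inPn noX].
    exists a => _ _; split=> //; first by apply/eqP; rewrite eq_le rw0 rw_ge0.
    by move=> u ku; apply: contraL ku => /noX.
  have [k kP] : exists k : S -> {set A} -> A, forall t B, 0 < w t B -> t \notin W ->
      [/\ k t B \in B, rw t (k t B) = 0 & forall u, 0 < kap t (k t B) u -> u \notin W].
    by exists (fun t B => projT1 (cid (stay t B))) => t B; case: cid.
  move=> sW; apply/eqP; rewrite eq_le x0 andbT.
  (* [x] cut to 0 off [W] is a supersolution for the selector using [k] there, hence bounds [x]. *)
  pose v t := if t \in W then x t else 0.
  have <- : v s = 0 by rewrite /v (negbTE sW).
  apply: (hmin (fun t B => if t \in W then h t B else k t B)).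
  - move=> t B wB; case: ifP => tW; first exact: hv.
    by have [] := kP t B wB (negbT tW).
  - by move=> t; rewrite /v; case: ifP.
  move=> t; rewrite {2}/v; case: ifP => tW.
    rewrite [leRHS]xE; apply: ler_mean => B _; rewrite lerD2l; apply: ler_mean => u _.
    by rewrite /v; case: ifP.
  rewrite -[leRHS](mean_cst (w t)); apply: ler_mean => B wB.
  have [_ r0 kW] := kP t B wB (negbT tW).
  rewrite /action_value r0 add0r -[leRHS](mean_cst (kap t (k t B))).
  by apply: ler_mean => u /kW; rewrite /v => /negbTE ->.
exists x, lam, bs; split=> //; first by exists h.
  move=> s; rewrite leNgt; apply/negP => lt.
  (* Otherwise using [g] at [s] alone would lower the value there, against the minimality of [h]. *)
  have h'v : valid w (fun t => if t == s then g t else h t).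
    by move=> t B wB; case: ifP => _; [exact: gv|exact: hv].
  pose v t := if t == s then mean (w s) (lam s) else x t.
  have vx t : v t <= x t by rewrite /v; case: eqP => // ->; rewrite ltW.
  have : x s <= v s.
    apply: (hmin _ _ h'v) => t.
      rewrite /v; case: ifP => // _; apply: mean_ge0 => B _.
      by rewrite addr_ge0 // mean_ge0.
    rewrite {2}/v; case: eqP => [->|_]; last rewrite [leRHS]xE.
      by apply: ler_mean => B _; rewrite lerD2l ler_mean.
    by apply: ler_mean => B _; rewrite lerD2l ler_mean.
  by rewrite /v eqxx leNgt lt.
move=> w' w'w lamx w'bs law D DB lawE Vlaw s.
rewrite -[leRHS]value_fineK // lee_fin.
have meanE t f : mean (law t) f = mean (w' t) (fun B => mean (D t B) f).
  by rewrite lawE mean_mixture.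
apply: value_ge => // [t|E c c0 bE xc].
  rewrite -mean_action_value meanE; apply: le_trans (lamx t) _.
  apply: ler_mean => B wB; rewrite -[leLHS](mean_cst (D t B)); apply: ler_mean => a Da.
  have [_] := gP t B (w_ne (w'w _ _ wB)); apply.
  exact: DB wB Da.
apply/eqP; rewrite -[_ == _]negbK; apply/negP => E0.
have EW : E \subset W.
  apply/fintype.subsetP => t tE; rewrite -[_ \in _]negbK; apply/negP => /xW xt.
  by have := xc t tE; rewrite xt => e; rewrite -e ltxx in c0.
(* At [t] both alternatives fail: an action from [bs t] would earn or could leave [E], and a set
   with [lam] above [x] is impossible, since the actions drawn earn nothing and stay where [x] is
   [c]. *)
have [t tE bst] := bsP E E0 EW.
have [gain0 Et] := bE t tE.
have law0 a : 0 < law t a -> rw t a = 0.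
  move=> la; apply/esym; apply: (mean_le_eq (m := law t) (f := fun=> 0) _ _ la) => //.
  by rewrite mean_cst gain0.
have lawE' a : 0 < law t a -> forall u, 0 < kap t a u -> u \in E.
  by move=> la u ku; apply: Et; apply: mixture_pos ku.
case: (w'bs t) => [[B wB xB]|wB].
  have [a Da] := dist_pos (D t B).
  have la : 0 < law t a by rewrite lawE; apply: mixture_pos Da.
  have [_ /(_ a (DB _ _ _ wB Da))] := gP t B (w_ne (w'w _ _ wB)).
  rewrite -/(lam t B) /action_value law0 // add0r.
  rewrite (eq_mean (g := fun=> c)) => [|u /(lawE' _ la)/xc //].
  by rewrite mean_cst -(xc t tE) leNgt xB.
have [a Da] := dist_pos (D t (bs t)).
have la : 0 < law t a by rewrite lawE; apply: mixture_pos Da.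
case: (bst a (DB _ _ _ wB Da)) => [|[u uE ku]]; first by rewrite law0 // ltxx.
by rewrite (lawE' a la u ku) in uE.
Qed.

End RewardKept.

(** * Games and multi-strategies as decision processes *)

Section Translation.
Variables (R : realType) (Sc Se A : finType) (G : game Sc Se A).
Implicit Types (theta : multi_strategy R G) (sigma : strategy R G).
Implicit Types (pi : env_strategy R G).
Local Notation state := (Sc + Se)%type.

(* An environment state behaves like a controller state in which the set of
   all enabled actions is allowed with probability 1. *)
Definition choice_law theta (s : state) : dist R {set A} :=
  match s with inl c => theta c | inr e => dirac_dist R (enabled G (inr e)) end.

Lemma multi_strategy_pos theta c B : 0 < theta c B ->
  B != finset.set0 /\ B \subset enabled G (inl c).
Proof.
move=> tB; split; last by apply: (multi_strategy_enabled (m := theta)); rewrite inE.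
by apply: contraTneq tB => ->; rewrite multi_strategy_set0 ltxx.
Qed.

(** [pi] witnesses that every environment state has an enabled action. *)
Lemma choice_law_pos theta pi s B : 0 < choice_law theta s B ->
  B != finset.set0 /\ B \subset enabled G s.
Proof.
case: s => [c|e] /=; first exact: multi_strategy_pos.
rewrite dirac_pos => /eqP->; split=> //; have [a ea] := dist_pos (pi e).
apply/set0Pn; exists a; apply: (fintype.subsetP (env_strategy_enabled pi e)).
by rewrite inE.
Qed.

Lemma expected_rewardE sigma pi s (rw : state -> A -> R) :
  (forall s a, 0 <= rw s a) -> expected_reward sigma pi s rw =
  policy_value (succ_law R G) rw (action_law sigma pi) s.
Proof. by move=> rw0; exact: expected_reward_value. Qed.

(** Drawing a set and then an action in it, at all states at once, is the form that [reward_kept]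
    expects; at environment states the second draw is [pi]. *)
Lemma complies_law sigma theta pi : complies sigma theta ->
  exists D : state -> {set A} -> dist R A,
    (forall s B a, 0 < choice_law theta s B -> 0 < D s B a -> a \in B) /\
    (forall s, action_law sigma pi s = mixture (choice_law theta s) (D s)).
Proof.
move=> [d [dB sE]].
exists (fun s B => match s with inl c => d c B | inr e => pi e end); split.
  move=> [c|e] B a /=.
    move=> /multi_strategy_pos[B0 Ben] da.
    by apply: (fintype.subsetP (dB c B B0 Ben)); rewrite inE.
  rewrite dirac_pos => /eqP-> pa.
  by apply: (fintype.subsetP (env_strategy_enabled pi e)); rewrite inE.
move=> [c|e]; apply: eq_dist => a; rewrite mixtureE /=; last by rewrite mean_dirac.
have d0 B : 0 < theta c B -> a \notin B -> d c B a = 0.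
  move=> /multi_strategy_pos[B0 Ben] aB; apply/eqP; rewrite eq_le dist_ge0 andbT.
  rewrite leNgt; apply: contra aB => da.
  by apply: (fintype.subsetP (dB c B B0 Ben)); rewrite inE.
have [aen|aen] := boolP (a \in enabled G (inl c)).
  rewrite sE // /mean big_mkcond; apply: eq_bigr => B _.
  have := dist_ge0 (theta c) B; rewrite le0r => /predU1P[->|tB].
    by rewrite !mul0r; case: ifP.
  have [_ ->] := multi_strategy_pos tB; case: ifP => //= /negbT aB.
  by rewrite d0 ?mulr0.
have -> : sigma c a = 0.
  apply/eqP; rewrite eq_le dist_ge0 andbT leNgt; apply: contra aen => sa.
  by apply: (fintype.subsetP (strategy_enabled sigma c)); rewrite inE.
rewrite -[LHS](mean_cst (theta c)); apply: eq_mean => B tB; rewrite d0 //.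
have [_ Ben] := multi_strategy_pos tB.
by apply: contra aen => aB; exact: (fintype.subsetP Ben).
Qed.

(** Realises selector values by actual strategies, so that soundness and the dynamic penalty of
    [theta] apply to them. *)
Lemma selector_strategies theta pi h (a0 : A) : valid (choice_law theta) h ->
  exists sigma pi', complies sigma theta /\
    forall s (rw : state -> A -> R), (forall s a, 0 <= rw s a) ->
    expected_reward sigma pi' s rw =
    policy_value (succ_law R G) rw (sel_law (choice_law theta) h) s.
Proof.
move=> hv; pose law := sel_law (choice_law theta) h.
have law_en s : supp (law s) \subset enabled G s.
  apply/fintype.subsetP => a; rewrite inE => /mixture_posE[B wB].
  rewrite dirac_pos => /eqP->; have [_ Ben] := choice_law_pos pi wB.
  exact: (fintype.subsetP Ben) (hv _ _ wB).
pose sigma := Strategy (fun c => law_en (inl c)).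
pose pi' := EnvStrategy (fun e => law_en (inr e)).
exists sigma, pi'; split; last first.
  move=> s rw rw0; rewrite expected_rewardE //; congr policy_value.
  by apply/funext => -[].
have [g gP] := greedy_ex a0 (fun (_ : state) (_ : A) => 0 : R).
(* [complies] also constrains sets of probability 0, where [h] may leave the set; [g] then supplies
   a member. *)
pose k c B := if h (inl c) B \in B then h (inl c) B else g (inl c) B.
exists (fun c B => dirac_dist R (k c B)); split=> [c B B0 _|c a aen].
  apply/fintype.subsetP => a; rewrite inE dirac_pos => /eqP->; rewrite /k.
  by case: ifP => // _; have [] := gP (inl c) B B0.
rewrite [LHS]mixtureE /mean [RHS]big_mkcond; apply: eq_bigr => B _ /=.
have := dist_ge0 (theta c) B; rewrite le0r => /predU1P[->|tB].
  by rewrite !mul0r; case: ifP.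
have [_ ->] := multi_strategy_pos tB; have hB := hv (inl c) B tB.
rewrite /= /k hB; case: ifP => // /negbT aB.
by rewrite ffunE; case: eqP aB => [->|]; rewrite ?hB ?mulr0.
Qed.

Lemma sub_multi_strategy theta (m : Sc -> dist R {set A}) :
  (forall c B, 0 < m c B -> 0 < theta c B) ->
  exists theta' : multi_strategy R G, forall c, multi_strategy_fun theta' c = m c.
Proof.
move=> mt; have m0 c : m c finset.set0 = 0.
  apply/eqP; rewrite eq_le dist_ge0 andbT leNgt; apply/negP => /mt.
  by rewrite multi_strategy_set0 ltxx.
have men c (B : {set A}) : B \in supp (m c) -> B \subset enabled G (inl c).
  by rewrite inE => /mt/multi_strategy_pos[].
by exists (MultiStrategy m0 men).
Qed.

Definition pen_set (psi : Sc -> A -> rat) c (B : {set A}) : R :=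
  \sum_(a in enabled G (inl c) :\: B) ratr (psi c a).

Lemma pen_locE psi theta c : pen_loc psi theta c = mean (theta c) (pen_set psi c).
Proof.
rewrite /pen_loc /mean big_mkcond; apply: eq_bigr => B _.
have := dist_ge0 (theta c) B; rewrite le0r => /predU1P[->|tB].
  by rewrite mul0r; case: ifP => // _; apply: big1 => a _; rewrite mul0r.
by have [_ ->] := multi_strategy_pos tB; rewrite -mulr_sumr.
Qed.

Lemma pen_reward_ge0 (psi : Sc -> A -> rat) theta : (forall s a, 0 <= psi s a) ->
  forall s a, 0 <= pen_reward psi theta s a.
Proof.
move=> psi0 [c|e] a //=; rewrite pen_locE; apply: mean_ge0 => B _.
by apply: sumr_ge0 => b _; rewrite ler0q.
Qed.

(** [mu] is left free: the static case takes the penalty of the set, the dynamic case adds a future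
    penalty. *)
Lemma sound_reduction (r : state -> A -> rat) (b : R) theta
    (mu : Sc -> {set A} -> R) :
  (forall s a, 0 <= r s a) -> bounded_reward R G r -> sound r b theta ->
  exists2 theta' : multi_strategy R G, sound r b theta' & forall c,
    [/\ (#|supp (theta' c)| <= 2)%N, forall B, 0 < theta' c B -> 0 < theta c B
      & mean (theta' c) (mu c) <= mean (theta c) (mu c)].
Proof.
move=> r0 r_fin theta_sound.
(* Without environment strategies soundness is vacuous; the first coordinate is then constant and
   only [mu] counts. *)
have [[pi _]|no_pi] := pselect (exists pi : env_strategy R G, True); last first.
  have ex c : exists m : dist R {set A}, [/\ forall B, 0 < m B -> 0 < theta c B,
      (#|supp m| <= 2)%N & mean m (mu c) <= mean (theta c) (mu c)].
    have [B0 tB0] := dist_pos (theta c).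
    have [|m [m1 m2 _ m3 _]] := @two_point _ _ (theta c) (fun=> 0) (mu c) 0 B0 _ tB0.
      by rewrite mean_cst.
    by exists m.
  have [theta' t'E] := @sub_multi_strategy theta (fun c => projT1 (cid (ex c)))
    (fun c => let: And3 h _ _ := projT2 (cid (ex c)) in h).
  exists theta' => [sigma _ pi|c]; first by case: no_pi; exists pi.
  by rewrite t'E; case: cid => m [].
have [a0 _] : exists a : A, true.
  have [B wB] := dist_pos (choice_law theta (init G)).
  by have [/set0Pn[a _] _] := choice_law_pos pi wB; exists a.
have w_ne s B : 0 < choice_law theta s B -> B != finset.set0.
  by move=> /(choice_law_pos pi)[].
have rw0 s a : 0 <= rat_reward R r s a by rewrite ler0q.
have e_fin sigma pi' s : (expected_reward sigma pi' s (rat_reward R r) < +oo)%E.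
  by apply: le_lt_trans (r_fin s); apply: ereal_sup_ubound; exists sigma, pi'.
have V_fin h : valid (choice_law theta) h -> forall s,
    (policy_value (succ_law R G) (rat_reward R r) (sel_law (choice_law theta) h) s < +oo)%E.
  move=> hv s; have [sigma [pi' [_ e]]] := selector_strategies pi a0 hv.
  by rewrite -e.
have [x [lam [bs [[h hv hx] xlam wbs keep]]]] := reward_kept w_ne a0 rw0 V_fin.
have ex c := two_point (mu c) (xlam (inl c)) (wbs (inl c)).
have [theta' t'E] := @sub_multi_strategy theta (fun c => projT1 (cid (ex c)))
  (fun c => let: And5 h _ _ _ _ := projT2 (cid (ex c)) in h).
have t'P c : [/\ forall B, 0 < theta' c B -> 0 < theta c B,
    (#|supp (theta' c)| <= 2)%N, x (inl c) <= mean (theta' c) (lam (inl c)),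
    mean (theta' c) (mu c) <= mean (theta c) (mu c) &
    (exists2 B, 0 < theta' c B & x (inl c) < lam (inl c) B) \/
      0 < theta' c (bs (inl c))].
  by rewrite t'E; case: cid.
exists theta' => [sigma cs pi'|c]; last by have [] := t'P c.
have [D [DB lawE]] := complies_law pi' cs.
(* [h] is realised by strategies complying with [theta], hence [b] is at most [x] at the initial
   state. *)
have [sigma0 [pi0 [c0 e0]]] := selector_strategies pi a0 hv.
have := theta_sound _ c0 pi0; rewrite e0 // hx => /le_trans; apply.
rewrite expected_rewardE //; apply: keep DB lawE _ _.
- by move=> [c|e] B //=; have [tB _ _ _ _] := t'P c; exact: tB.
- by move=> [c|e] /=; [have [] := t'P c|exact: (xlam (inr e))].
- move=> [c|e] /=; first by have [_ _ _ _] := t'P c.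
  by right; exact: (wbs (inr e)).
- by move=> s; rewrite -expected_rewardE.
Qed.

(** [mu] adds to the penalty of a set the largest mean of the optimal penalty [y] after it. As its
    average does not increase, [y] stays a supersolution for [theta'] on the finite states. *)
Lemma pen_dyn_reduction (r : state -> A -> rat) (b : R) (psi : Sc -> A -> rat) theta :
  (forall s a, 0 <= r s a) -> bounded_reward R G r ->
  (forall s a, 0 <= psi s a) -> sound r b theta ->
  exists theta' : multi_strategy R G, [/\ sound r b theta',
    (pen_dyn psi theta' <= pen_dyn psi theta)%E
    & forall c, (#|supp (theta' c)| <= 2)%N].
Proof.
move=> r0 r_fin psi0 theta_sound.
have [[pi _]|no_pi] := pselect (exists pi : env_strategy R G, True); last first.
  have [theta' t's t'P] := sound_reduction (fun _ _ => 0) r0 r_fin theta_sound.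
  exists theta'; split=> // [|c]; last by have [] := t'P c.
  by apply: ge_ereal_sup => v [sigma [pi _]]; case: no_pi; exists pi.
have [pen_oo|pen_fin] := eqVneq (pen_dyn psi theta) +oo%E.
  have [theta' t's t'P] := sound_reduction (fun _ _ => 0) r0 r_fin theta_sound.
  exists theta'; split=> // [|c]; last by have [] := t'P c.
  by rewrite pen_oo leey.
have [a0 _] : exists a : A, true.
  have [B wB] := dist_pos (choice_law theta (init G)).
  by have [/set0Pn[a _] _] := choice_law_pos pi wB; exists a.
have w_ne s B : 0 < choice_law theta s B -> B != finset.set0.
  by move=> /(choice_law_pos pi)[].
have rw0 := pen_reward_ge0 theta psi0.
pose kap := succ_law R G; pose w := choice_law theta.
have V_le h : valid w h ->
    (policy_value kap (pen_reward psi theta) (sel_law w h) (init G) <= pen_dyn psi theta)%E.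
  move=> hv; have [sigma [pi' [cs e]]] := selector_strategies pi a0 hv.
  by rewrite -e //; apply: ereal_sup_ubound; exists sigma, pi'.
pose Fin := finite_states kap w (pen_reward psi theta).
have initF : init G \in Fin.
  rewrite inE; apply/asboolP => h hv; apply: le_lt_trans (V_le h hv) _.
  by rewrite ltey.
have [y [y0 [h hv yh]] yP] := max_selector_finite kap w_ne a0 rw0.
(* Minimising the negated mean picks the action with the largest future penalty. *)
have [g gP] := greedy_ex a0 (fun s a => - mean (kap s a) y).
pose K s B := mean (kap s (g s B)) y.
have KP s (B : {set A}) a : a \in B -> mean (kap s a) y <= K s B.
  move=> aB; rewrite -lerN2; have B0 : B != finset.set0 by apply/set0Pn; exists a.
  by have [_] := gP s B B0; apply.
have [theta' t's t'P] :=
  sound_reduction (fun c B => pen_set psi c B + K (inl c) B) r0 r_fin theta_sound.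
exists theta'; split=> // [|c]; last by have [] := t'P c.
pose w' := choice_law theta'.
have w'w s B : 0 < w' s B -> 0 < w s B.
  by case: s => [c|e] //=; have [_ tB _] := t'P c; exact: tB.
have step s : s \in Fin -> forall a,
    pen_reward psi theta' s a + mean (w' s) (K s) <= y s.
  move=> sF a; apply: (@le_trans _ _ (pen_reward psi theta s a + mean (w s) (K s))).
    case: s {sF} => [c|e] //=; rewrite !pen_locE -!meanD.
    by have [] := t'P c.
  have := yP s (g s) sF; rewrite meanD.
  rewrite (eq_mean (f := fun B => pen_reward psi theta s (g s B))
    (g := fun=> pen_reward psi theta s a)); last by case: (s).
  by rewrite mean_cst; apply => B /w_ne/(gP s)[].
apply: ge_ereal_sup => _ [sigma [pi' [cs ->]]].
have [D [DB lawE]] := complies_law pi' cs.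
have rw'0 := pen_reward_ge0 theta' psi0.
rewrite expected_rewardE //; apply: le_trans (V_le h hv); apply: le_trans (yh _).
(* Infinite outside [Fin], which [theta'] never leaves once inside, its sets being among those of
   [theta]. *)
pose v s : \bar R := if s \in Fin then (y s)%:E else +oo%E.
have <- : v (init G) = (y (init G))%:E by rewrite /v initF.
apply: value_le => [s|s|s]; first exact: policy_gain_ge0.
  by rewrite /v; case: ifP => // _; rewrite lee_fin.
rewrite {2}/v; case: ifP => sF; last exact: leey.
have lawP a : 0 < action_law sigma pi' s a -> exists2 B, 0 < w' s B & a \in B.
  rewrite lawE => /mixture_posE[B wB Da]; exists B => //; exact: DB wB Da.
rewrite (eq_emean (g := fun t => (y t)%:E)) => [|t /mixture_posE[a /lawP[B wB aB] kt]].
  rewrite emean_EFin -EFinD lee_fin -mean_action_value lawE mean_mixture.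
  apply: le_trans (step s sF a0); rewrite -[X in X + _](mean_cst (w' s)) -meanD.
  apply: ler_mean => B wB.
  rewrite -[leRHS](mean_cst (D s B)); apply: ler_mean => a Da; apply: lerD.
    by case: (s).
  by apply: KP; exact: DB wB Da.
by rewrite /v (finite_states_closed rw0 sF (w'w _ _ wB) aB kt).
Qed.

End Translation.

Theorem theorem4p4 (R : realType) (Sc Se A : finType) (G : game Sc Se A)
    (r : Sc + Se -> A -> rat) (b : R)
    (psi : Sc -> A -> rat) (tau : penalty_type)
    (r_ge0 : forall s a, 0 <= r s a)
    (r_bounded : bounded_reward R G r)
    (psi_ge0 : forall s a, 0 <= psi s a)
    (theta : multi_strategy R G) (theta_sound : sound r b theta) :
  exists theta' : multi_strategy R G,
    [/\ sound r b theta',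
        (penalty psi tau theta' <= penalty psi tau theta)%E
      & forall s : Sc, (#|supp (theta' s)| <= 2)%N].
Proof.
case: tau => /=; last exact: (pen_dyn_reduction r_ge0 r_bounded psi_ge0 theta_sound).
have [theta' t's t'P] :=
  sound_reduction (pen_set R G psi) r_ge0 r_bounded theta_sound.
exists theta'; split=> // [|s]; last by have [] := t'P s.
rewrite lee_fin; apply: ler_sum => s _; rewrite !pen_locE.
by have [] := t'P s.
Qed.
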